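(* Let $s\ge 3$, $d>s$, $e+1=d-s$, and let $T\subset S^dU$ be a subspace with $\dim T=e+1$ such that $f=\pi_T\circ\nu_d:\mathbb{P}^1=\mathbb{P}(U)\to\mathbb{P}(S^dU/T)=\mathbb{P}^s$ is a morphism which is birational onto its image $C=f(\mathbb{P}^1)$, where $C$ has ordinary singularities. Then for every integer $k\geq 1$ one has $$h^0(\mathbb{P}^1,\mathcal{T}_f(-d-2-k))=\dim\big(\ker D\cap(S^kU\otimes T)\big),$$ $$h^0(\mathbb{P}^1,\mathcal{N}_f(-d-2-k))=\dim\big(\ker D^2\cap(S^kU\otimes T)\big),$$ where $D:S^kU\otimes S^dU\to S^{k-1}U\otimes S^{d-1}U$ and $D^2:S^kU\otimes S^dU\to S^{k-2}U\otimes S^{d-2}U$ (with $D^2$ the zero map when $k=1$).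
   Context: $U=\langle x,y\rangle$ is a two-dimensional complex vector space; $S^iU$ is its $i$-th symmetric power ($S^iU=0$ for $i<0$). $\mathbb{P}(W)$ is the projective space of one-dimensional subspaces of $W$. $\nu_d:\mathbb{P}(U)\to\mathbb{P}(S^dU)$, $[p]\mapsto[p^d]$, is the Veronese embedding, with image the rational normal curve $C_d$. $\pi_T:\mathbb{P}(S^dU)\dashrightarrow\mathbb{P}(S^dU/T)$ is the linear projection with vertex $\mathbb{P}(T)$; $\pi_T\circ\nu_d$ being a morphism given by degree $d$ forms without common zeros means $\mathbb{P}(T)\cap C_d=\emptyset$. Up to projective transformation every non-degenerate degree $d$ rational curve in $\mathbb{P}^s$ arises in this way. $\mathcal{T}_f=f^*\mathcal{T}_{\mathbb{P}^s}$ is the restricted tangent bundle. As $C$ has ordinary singularities, $df:\mathcal{T}_{\mathbb{P}^1}\to f^*\mathcal{T}_{\mathbb{P}^s}$ is an embedding of vector bundles, and $\mathcal{N}_f=f^*\mathcal{T}_{\mathbb{P}^s}/df(\mathcal{T}_{\mathbb{P}^1})$ is the normal bundle. $\mathcal{F}(m)=\mathcal{F}\otimes\mathcal{O}_{\mathbb{P}^1}(m)$. The operator $D=\partial_x\otimes\partial_y-\partial_y\otimes\partial_x$ acts as a differential operator (partial derivatives acting on each tensor factor), and $D^2=D\circ D=\partial_x^2\otimes\partial_y^2-2\,\partial_x\partial_y\otimes\partial_x\partial_y+\partial_y^2\otimes\partial_x^2$. *)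

(* Defs.v *)
From HB Require Import structures.
From mathcomp Require Import all_boot all_order all_algebra.
From mathcomp Require Import mpoly.
From mathcomp Require Import complex.
From mathcomp Require Import reals.

Set Implicit Arguments.
Unset Strict Implicit.
Unset Printing Implicit Defensive.

Import GRing.Theory.
Local Open Scope ring_scope.

(* Every polynomial ring in two variables below has type [{mpoly C[2]}], with   *)
(* two distinct roles.  As the symmetric algebra of U = <x, y>, with x = 'X_0   *)
(* and y = 'X_1, it contains S^d U = [dhomog 2 C d].  As the homogeneous        *)
(* coordinate ring of P(U) its variables are the coordinates of p = p_0 x +     *)
(* p_1 y.  A point of P(U) is given by a nonzero [p : 'rV[C]_2].                *)

Lemma var_homog (C : fieldType) n (i : 'I_n) r :
  ('X_i : {mpoly C[n]}) ^+ r \is r.-homog.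
Proof.
rewrite -[X in X.-homog]mul1n; apply: dhomogMn.
by rewrite dhomogX /= mdeg1.
Qed.

Section Veronese.
Variable C : fieldType.

Definition linear_form (p : 'rV[C]_2) : {mpoly C[2]} :=
  p 0 0 *: 'X_0 + p 0 1 *: 'X_1.

Lemma veronese_homog d p : linear_form p ^+ d \is d.-homog.
Proof.
rewrite -[X in X.-homog]mul1n; apply: dhomogMn.
by rewrite rpredD // rpredZ // -['X__]expr1 var_homog.
Qed.

Definition veronese d (p : 'rV[C]_2) : dhomog 2 C d :=
  DHomog (veronese_homog d p).

Definition binary_monomial d (i : nat) : {mpoly C[2]} :=
  'X_0 ^+ (d - i) * 'X_1 ^+ i.

Lemma binary_monomial_homog d (i : 'I_d.+1) : binary_monomial d i \is d.-homog.
Proof.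
rewrite -[X in X.-homog](@subnK i d) -1?ltnS //.
by apply: dhomogM; apply: var_homog.
Qed.

(* The degree d forms on P(U) defining p |-> pi (p ^ d); see [curve_formsE].    *)
Definition curve_forms d s (pi : 'Hom(dhomog 2 C d, 'rV[C]_s.+1))
    (j : 'I_s.+1) : {mpoly C[2]} :=
  \sum_(i < d.+1)
    ('C(d, i)%:R * pi (DHomog (binary_monomial_homog i)) 0 j)
      *: binary_monomial d i.

Lemma curve_formsE d s (pi : 'Hom(dhomog 2 C d, 'rV[C]_s.+1)) j (p : 'rV[C]_2) :
  (curve_forms pi j).@[p 0] = pi (veronese d p) 0 j.
Proof.
have -> : veronese d p = \sum_(i < d.+1)
    ('C(d, i)%:R * (p 0 0 ^+ (d - i) * p 0 1 ^+ i))
      *: DHomog (binary_monomial_homog i).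
  apply: val_inj; rewrite /= /linear_form exprDn raddf_sum /=.
  apply: eq_bigr => i _.
  rewrite !exprZn -scalerAl -scalerAr scalerA -scaler_nat scalerA.
  by congr (_ *: _).
rewrite /curve_forms raddf_sum (linear_sum pi) summxE /=.
apply: eq_bigr => i _; rewrite mevalZ (linearZ_LR pi) mxE /binary_monomial.
by rewrite mevalM !rmorphXn /= !mevalXU mulrAC.
Qed.

Lemma curve_forms_homog d s (pi : 'Hom(dhomog 2 C d, 'rV[C]_s.+1)) j :
  curve_forms pi j \is d.-homog.
Proof. by apply: rpred_sum => i _; apply/rpredZ/binary_monomial_homog. Qed.

End Veronese.

(* The forms F j are the components of a morphism P(U) -> P^n. *)
Section Curve.
Variables (C : fieldType) (n : nat) (F : 'I_n.+1 -> {mpoly C[2]}).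

Definition curve_point (p : 'rV[C]_2) : 'rV[C]_n.+1 := \row_j (F j).@[p 0].

(* Existence of a rational inverse (G 0 : G 1) : P^n --> P(U), defined at the   *)
(* generic point of the image.                                                  *)
Definition birational_onto_image : Prop :=
  exists (r : nat) (G : 'I_2 -> {mpoly C[n.+1]}),
    let Gf k := G k \mPo [tuple F j | j < n.+1] in
    [/\ forall k, G k \is r.-homog,
        exists k, Gf k != 0
      & 'X_1 * Gf 0 = 'X_0 * Gf 1].

(* By Euler's formula the rows of the Jacobian matrix of the lift U -> C^(n+1)  *)
(* span, together with no further vector, the cone over the tangent line at p   *)
(* of the branch of the curve parametrized near p; this branch is smooth iff    *)
(* the rank is 2.                                                               *)
Definition jacobian (p : 'rV[C]_2) : 'M[C]_(2, n.+1) :=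
  \matrix_(k, j) ((F j)^`M(k)).@[p 0].

(* At each point of the image all branches are smooth, and distinct branches    *)
(* have distinct tangent lines.                                                 *)
Definition ordinary_singularities : Prop :=
  (forall p, p != 0 -> \rank (jacobian p) = 2%N) /\
  (forall p q, p != 0 -> q != 0 -> ~~ (p == q)%MS ->
     (curve_point p == curve_point q)%MS ->
     ~~ (jacobian p == jacobian q)%MS).

End Curve.

Section Sheaves.
Variable C : fieldType.

(* Fractions of forms of total degree m are the rational sections of O(m). *)
Local Notation K := {fraction {mpoly C[2]}}.
Local Notation "x %:F" := (FracField.tofrac x).

Definition cst (c : C) : K := (c%:MP_[2])%:F.

(* The stalk at p of the sheaf O(m) on P(U). *)
Definition O_stalk (m : int) (p : 'rV[C]_2) (phi : K) : Prop :=
  exists (r t : nat) (g h : {mpoly C[2]}),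
    [/\ g \is r.-homog, h \is t.-homog, r%:Z - t%:Z = m,
        h.@[p 0] != 0 & phi = g%:F / h%:F].

Section Tangent.
Variables (n : nat) (F : 'I_n.+1 -> {mpoly C[2]}).

(* Pullback of the affine coordinate z_j / z_i of the chart z_i <> 0 of P^n. *)
Definition coord (i j : 'I_n.+1) : K := (F j)%:F / (F i)%:F.

(* The stalk at p of f^* T_{P^n} (m), inside its generic stalk.  The entry a i j *)
(* is the component of the vector field along d/d(z_j / z_i) in the chart       *)
(* z_i <> 0, so that row i transforms into row l by the Jacobian matrix of      *)
(* z_j / z_l = (z_j / z_i) / (z_l / z_i).                                       *)
Definition tangent_stalk (m : int) (p : 'rV[C]_2) (a : 'M[K]_n.+1) : Prop :=
  (forall i j l, F i != 0 ->
     a l j = (a i j * coord i l - coord i j * a i l) / coord i l ^+ 2) /\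
  (forall i j, (F i).@[p 0] != 0 -> O_stalk m p (a i j)).

(* d(z_j / z_i) / dt for t = p_1 / p_0; on fractions of degree 0 the operator   *)
(* d/dt is p_0 d/dp_1.                                                          *)
Definition dcoord (i j : 'I_n.+1) : K :=
  ('X_0)%:F * ((F j)^`M(1) * F i - F j * (F i)^`M(1))%:F / (F i)%:F ^+ 2.

(* The differential T_{P(U)} -> f^* T_{P^n}.  A rational vector field b on P(U) *)
(* is determined by its component b 0 1 along d/dt, also away from p_0 <> 0.    *)
Definition differential (b : 'M[K]_2) : 'M[K]_n.+1 :=
  \matrix_(i, j) (dcoord i j * b 0 1).

End Tangent.

Definition TP1_stalk : int -> 'rV[C]_2 -> 'M[K]_2 -> Prop :=
  tangent_stalk (fun k : 'I_2 => 'X_k).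

Definition differential_image n (F : 'I_n.+1 -> {mpoly C[2]}) (m : int)
    (p : 'rV[C]_2) (a : 'M[K]_n.+1) : Prop :=
  exists2 b, TP1_stalk m p b & a = differential F b.

(* For sheaves S c E on P(U) given by their stalks inside the generic stalk V   *)
(* of E, the global sections of the quotient sheaf E / S: families of germs     *)
(* that locally come from a section of E.                                       *)
Section Sections.
Variables (V : lmodType K) (E S : 'rV[C]_2 -> V -> Prop).

Definition quotient_section (sigma : 'rV[C]_2 -> V) : Prop :=
  forall p : 'rV[C]_2, p != 0 ->
    exists (r : nat) (h : {mpoly C[2]}) (v : V),
      [/\ h \is r.-homog, h.@[p 0] != 0
        & forall q : 'rV[C]_2, q != 0 -> h.@[q 0] != 0 -> E q v /\ S q (sigma q - v)].

(* [N] is the dimension over C of H^0(P(U), E / S); two families define the     *)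
(* same section when they agree modulo S at every point.                        *)
Definition h0_quotient (N : nat) : Prop :=
  exists beta : 'I_N -> 'rV[C]_2 -> V,
    (forall i, quotient_section (beta i)) /\
    (forall sigma, quotient_section sigma ->
       exists! c : 'rV[C]_N, forall q, q != 0 ->
         S q (sigma q - \sum_(i < N) cst (c 0 i) *: beta i q)).

End Sections.

Section RestrictedTangentAndNormal.
Variables (n : nat) (F : 'I_n.+1 -> {mpoly C[2]}) (m : int).

Definition h0_restricted_tangent : nat -> Prop :=
  h0_quotient (tangent_stalk F m) (fun _ a => a = 0).

Definition h0_normal : nat -> Prop :=
  h0_quotient (tangent_stalk F m) (differential_image F m).

End RestrictedTangentAndNormal.
End Sheaves.

(* S^k U (x) S^d U is modelled by the polynomials of bidegree (k, d) in         *)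
(* ('X_0, 'X_1; 'X_2, 'X_3), inside those of degree k + d.                      *)
Section Tensor.
Variable C : fieldType.

Definition left_factor (u : {mpoly C[2]}) : {mpoly C[4]} :=
  u \mPo [tuple 'X_0; 'X_1].

Definition right_factor (u : {mpoly C[2]}) : {mpoly C[4]} :=
  u \mPo [tuple 'X_2; 'X_3].

Lemma comp_homog d (i j : 'I_4) (u : {mpoly C[2]}) :
  u \is d.-homog -> u \mPo [tuple ('X_i : {mpoly C[4]}); 'X_j] \is d.-homog.
Proof.
move=> /dhomogP hu; rewrite comp_mpolyE big_seq rpred_sum // => m /hu <-.
rewrite rpredZ // big_ord_recl big_ord1 /= /tnth /=.
rewrite mdegE big_ord_recl big_ord1.
by apply: dhomogM; apply: var_homog.
Qed.

Definition tens k d (u : dhomog 2 C k) (v : dhomog 2 C d) :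
    dhomog 4 C (k + d) :=
  DHomog (dhomogM (comp_homog 0 1 (dhomog_is_dhomog u))
                  (comp_homog 2 3 (dhomog_is_dhomog v))).

Lemma tensE k d (u : dhomog 2 C k) (v : dhomog 2 C d) :
  tens u v = left_factor u * right_factor v :> {mpoly C[4]}.
Proof. by []. Qed.

Definition Sym_tens k d (T : {vspace dhomog 2 C d}) :
    {vspace dhomog 4 C (k + d)} :=
  <<[seq tens u v | u <- vbasis (fullv : {vspace dhomog 2 C k}),
                    v <- vbasis T]>>%VS.

Lemma mderiv_homog d (i : 'I_4) (u : {mpoly C[4]}) :
  u \is d.-homog -> u^`M(i) \is d.-1.-homog.
Proof.
move=> /dhomogP hu; rewrite /mderiv big_seq rpred_sum // => m /hu hm.
have [-> | mi] := eqVneq (m i) 0%N; first by rewrite mul0r scale0r rpred0.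
have le_im : (U_(i) <= m)%MM.
  by apply/mnm_lepP => j; rewrite mnm1E; case: eqP => // <-; rewrite lt0n.
have hm' : d = (mdeg (m - U_(i))%MM).+1.
  by rewrite -hm -[in LHS](submK le_im) /= mdegD mdeg1 addn1.
by rewrite rpredZ // dhomogX /= hm'.
Qed.

Definition D_poly (u : {mpoly C[4]}) : {mpoly C[4]} :=
  (u^`M(3))^`M(0) - (u^`M(2))^`M(1).

Lemma D_homog N (u : dhomog 4 C N) : D_poly u \is N.-2.-homog.
Proof. by apply: rpredB; do 2!apply: mderiv_homog; apply: dhomog_is_dhomog. Qed.

Definition D_fun N (u : dhomog 4 C N) : dhomog 4 C N.-2 := DHomog (D_homog u).

Lemma D_is_linear N : linear (@D_fun N).
Proof.
move=> c u v; apply: val_inj; rewrite /= /D_poly !mderivD !mderivZ.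
by rewrite scalerBr opprD addrACA.
Qed.

HB.instance Definition _ N :=
  GRing.isLinear.Build C (dhomog 4 C N) (dhomog 4 C N.-2) *:%R (@D_fun N)
    (@D_is_linear N).

Definition D N : 'Hom(dhomog 4 C N, dhomog 4 C N.-2) := linfun (@D_fun N).

Definition D2 N : 'Hom(dhomog 4 C N, dhomog 4 C N.-2.-2) :=
  (D N.-2 \o D N)%VF.

End Tensor.

Arguments D {C} N.
Arguments D2 {C} N.

(* Main.v *)
(* By the Euler sequence, T_f(-d-2-k) is the cokernel of the row of forms
   F : O(-d-2-k) -> O(-2-k)^(s+1) defining f, and N_f(-d-2-k) is the cokernel of
   the Jacobian matrix O(-d-1-k)^2 -> O(-2-k)^(s+1).  As the target has no global
   sections, the sections of such a cokernel form the kernel of the map induced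
   on H^1.  This is computed with Cech cocycles for the cover X_0 <> 0, X_1 <> 0,
   and is the space of (pairs of) linear functionals l on forms that vanish on the
   products g F_j, resp. satisfy l_0(g dF_j/dX_0) + l_1(g dF_j/dX_1) = 0, for g of
   degree k.  On the other side, the functionals (g, F) |-> l(g F), resp.
   (g, F) |-> l_0(g dF/dX_0) + l_1(g dF/dX_1), on S^k (x) S^d are exactly the
   kernel of D, resp. D^2, and S^k U (x) T is the annihilator of the F_j. *)

From HB Require Import structures.
Require Import Defs.
From mathcomp Require Import all_boot all_order all_algebra.
From mathcomp Require Import mpoly complex reals.
From mathcomp Require Import ring zify.

Set Implicit Arguments.
Unset Strict Implicit.
Unset Printing Implicit Defensive.

Import GRing.Theory.
Local Open Scope ring_scope.

(** * Binary forms *)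

(** Sections of a quotient sheaf are families of germs in the function field, so every statement
    about cohomology is reduced to divisibility of binary forms. Vanishing of H^1 on an affine chart
    becomes strong approximation: a principal part at one point is realised by a fraction whose only
    other poles lie on X_0 = 0, and local lifts can then be glued over the whole chart.

    With D = k + delta, where delta is d for F and d - 1 for its Jacobian matrix, H^1(O(-D-2)) has
    as basis the X_0^(-i) X_1^(-j) with i, j >= 1 and i + j = D + 2. Hence the denominator (X_0
    X_1)^(D+1) and numerators of degree D.

    In divided-power coordinates t_(a,b) the operator D is the difference t_(a,b+1) - t_(a+1,b)
    along the antidiagonal a + b = c. Its kernel consists of the arrays constant on each
    antidiagonal, with value l_c. The kernel of D^2 consists of the arrays affine on each one; the
    values of the affine function at b = 0 and b = d are, up to the factor d, the coefficients of
    l_0 and l_1. The two corner antidiagonals have one entry and carry one value each, which leaves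
    k + d coefficients for each of l_0 and l_1. *)

Section BinaryForms.
Variable C : numClosedFieldType.
Local Notation form := {mpoly C[2]}.
Implicit Types (g h z : form) (f : {poly C}) (p q : 'rV[C]_2) (r t : nat).

Definition mon2 r i : 'X_{1..2} := (U_(0%R) *+ (r - i) + U_(1%R) *+ i)%MM.

Lemma mon2_0 r i : mon2 r i 0 = (r - i)%N.
Proof. by rewrite mnmDE !mulmnE !mnm1E !eqE /=; lia. Qed.

Lemma mon2_1 r i : mon2 r i 1 = i.
Proof. by rewrite mnmDE !mulmnE !mnm1E !eqE /=; lia. Qed.

Lemma mdeg_mon2 r i : (i <= r)%N -> mdeg (mon2 r i) = r.
Proof. by move=> le; rewrite mdegD !mdegMn !mdeg1 !mul1n subnK. Qed.

Lemma mdeg2 (m : 'X_{1..2}) : mdeg m = (m 0%R + m 1%R)%N.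
Proof. by rewrite mdegE big_ord_recl big_ord1; congr (m _ + m _)%N; apply: val_inj. Qed.

Lemma mon2P r (m : 'X_{1..2}) : mdeg m = r -> m = mon2 r (m 1%R).
Proof.
rewrite mdeg2 => <-; apply/mnmP => -[[|[|//]] lt] /=.
  by rewrite (_ : Ordinal lt = 0) ?mon2_0 ?addnK //; apply: val_inj.
by rewrite (_ : Ordinal lt = 1) ?mon2_1 //; apply: val_inj.
Qed.

Lemma binary_monomialE r i : binary_monomial C r i = 'X_[mon2 r i].
Proof. by rewrite mpolyXD -!mpolyXn. Qed.

Lemma mon2_inj r i j : mon2 r i = mon2 r j -> i = j.
Proof. by move=> e; rewrite -(mon2_1 r i) e mon2_1. Qed.

(** Homogenization in t = X_1 / X_0, inverse to [dehomog] on forms of degree r; it makes the root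
    theory of univariate polynomials available. *)
Definition bform r f : form :=
  \sum_(i < r.+1) f`_i *: binary_monomial C r i.

Lemma bform_homog r f : bform r f \is r.-homog.
Proof. by apply: rpred_sum => i _; apply/rpredZ/binary_monomial_homog. Qed.

Lemma bform_coef r f i : (i <= r)%N -> (bform r f)@_(mon2 r i) = f`_i.
Proof.
move=> le; rewrite /bform raddf_sum /= (bigD1 (inord i)) //= big1 => [|j ne].
  by rewrite addr0 inordK // mcoeffZ binary_monomialE mcoeffX eqxx mulr1.
rewrite mcoeffZ binary_monomialE mcoeffX; case: eqP => [/mon2_inj e|]; last by rewrite mulr0.
by case/eqP: ne; apply: val_inj; rewrite /= inordK.
Qed.

Definition dehomog r h : {poly C} := \poly_(i < r.+1) h@_(mon2 r i).

Lemma size_dehomog r h : (size (dehomog r h) <= r.+1)%N.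
Proof. exact: size_poly. Qed.

Lemma dehomogK r h : h \is r.-homog -> bform r (dehomog r h) = h.
Proof.
move=> hh; apply/mpolyP => m.
have [em|ne] := eqVneq (mdeg m) r; last first.
  by rewrite !(dhomog_nemf_coeff _ ne) // bform_homog.
have le: (m 1%R <= r)%N by rewrite -em mdeg2 leq_addl.
by rewrite (mon2P em) bform_coef // coef_poly ltnS le.
Qed.

Lemma meval_bform r f p :
  (bform r f).@[p 0] = \sum_(i < r.+1) f`_i * (p 0 0 ^+ (r - i) * p 0 1 ^+ i).
Proof.
rewrite /bform raddf_sum /=; apply: eq_bigr => i _.
by rewrite mevalZ mevalM !rmorphXn /= !mevalXU.
Qed.

Lemma bform_is_linear r : linear (bform r).
Proof.
move=> c f1 f2; rewrite /bform scaler_sumr -big_split /=.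
by apply: eq_bigr => i _; rewrite coefD coefZ scalerDl scalerA.
Qed.

HB.instance Definition _ r :=
  GRing.isLinear.Build C {poly C} form *:%R (bform r) (@bform_is_linear r).

Lemma bformZ r c f : bform r (c *: f) = c *: bform r f.
Proof. exact: linearZ. Qed.

Lemma bformMX0 r f : (size f <= r.+1)%N -> bform r.+1 f = 'X_0 * bform r f.
Proof.
move=> sf; rewrite /bform big_ord_recr /= nth_default // scale0r addr0.
rewrite mulr_sumr; apply: eq_bigr => i _.
by rewrite -scalerAr /binary_monomial mulrA -exprS -subSn // -ltnS.
Qed.

Lemma bformMX1 r f : bform r.+1 ('X * f) = 'X_1 * bform r f.
Proof.
rewrite /bform big_ord_recl /= coefXM /= scale0r add0r mulr_sumr.
apply: eq_bigr => i _; rewrite coefXM /= -scalerAr /binary_monomial /bump /=.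
by rewrite add1n subSS mulrCA -exprS.
Qed.

Definition line p : form := p 0 0 *: 'X_1 - p 0 1 *: 'X_0.

Lemma line_homog p : line p \is 1.-homog.
Proof. by rewrite rpredB // rpredZ // -['X__]expr1 var_homog. Qed.

Lemma meval_line p q : (line p).@[q 0] = p 0 0 * q 0 1 - p 0 1 * q 0 0.
Proof. by rewrite mevalB !mevalZ !mevalXU. Qed.

Lemma line_self p : (line p).@[p 0] = 0.
Proof. by rewrite meval_line mulrC subrr. Qed.

Lemma row2_neq0 p : (p != 0) = (p 0 0 != 0) || (p 0 1 != 0).
Proof.
rewrite -negb_and; congr (~~ _); apply/eqP/andP => [-> | [/eqP e0 /eqP e1]].
  by rewrite !mxE eqxx.
apply/rowP => -[[|[|//]] lt]; rewrite mxE.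
  by rewrite -[RHS]e0; congr (p _ _); apply: val_inj.
by rewrite -[RHS]e1; congr (p _ _); apply: val_inj.
Qed.

Lemma form0_const h : h \is 0.-homog -> exists c, h = c%:MP.
Proof.
move/dehomogK => <-; exists (dehomog 0 h)`_0.
by rewrite /bform big_ord1 /binary_monomial !expr0 mulr1 -mul_mpolyC mulr1.
Qed.

(** The point at infinity of the chart X_0 <> 0 is treated apart: there vanishing means that the top
    coefficient is zero, elsewhere that p_1 / p_0 is a root of the dehomogenization. *)
Lemma root_line r h p : p != 0 -> h \is r.+1.-homog -> h.@[p 0] = 0 ->
  exists2 h', h' \is r.-homog & h = line p * h'.
Proof.
move=> p0 /dehomogK; set f := dehomog _ h => <-.
have sf: (size f <= r.+2)%N := size_dehomog _ _.
rewrite meval_bform /line; have [pe0|p00] := eqVneq (p 0 0) 0.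
  have p01: p 0 1 != 0 by move: p0; rewrite row2_neq0 pe0 eqxx.
  rewrite big_ord_recr /= big1 => [|i _]; last first.
    by rewrite pe0 subSn 1?expr0n ?mul0r ?mulr0 // -ltnS.
  rewrite add0r subnn mul1r => /eqP; rewrite mulf_eq0 expf_eq0 (negPf p01) andbF orbF => /eqP f0.
  exists (bform r (- (p 0 1)^-1 *: f)); first exact: bform_homog.
  rewrite pe0 scale0r sub0r mulNr -scalerAl bformZ -scalerAr -bformMX0; last first.
    rewrite leqNgt; apply/negP => lt; have e: size f = r.+2 by apply/eqP; rewrite eqn_leq sf.
    by have := lead_coef_eq0 f; rewrite lead_coefE e f0 eqxx -size_poly_eq0 e.
  by rewrite scalerA mulrN mulfV // scaleN1r opprK.
move=> ev; set t := p 0 1 / p 0 0.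
have rt: root f t.
  have: p 0 0 ^+ r.+1 * f.[t] = 0.
    rewrite -ev (horner_coef_wide _ sf) mulr_sumr; apply: eq_bigr => i _.
    have le: (i <= r.+1)%N by rewrite -ltnS.
    have ->: p 0 0 ^+ r.+1 = p 0 0 ^+ (r.+1 - i) * p 0 0 ^+ i by rewrite -exprD subnK.
    rewrite mulrCA -mulrA; congr (_ * (_ * _)).
    by rewrite -exprMn mulrC mulfVK.
  by move/eqP; rewrite mulf_eq0 expf_eq0 (negPf p00) andbF.
case/factor_theorem: rt sf => f' ->; have [->|f'0] := eqVneq f' 0.
  by move=> _; exists 0; rewrite ?rpred0 // mul0r linear0 mulr0.
rewrite size_Mmonic ?monicXsubC // size_XsubC addn2 /= ltnS => sf'.
exists (bform r ((p 0 0)^-1 *: f')); first exact: bform_homog.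
rewrite mulrBr linearB /= [_ * 'X]mulrC bformMX1 [f' * _]mulrC mul_polyC.
rewrite !bformZ bformMX0 // mulrBl -!scalerAl -!scalerAr !scalerA mulfV //.
by rewrite scale1r.
Qed.

Definition pt (a b : C) : 'rV[C]_2 := \row_j (if j == 0 then a else b).

Lemma pt_0 a b : pt a b 0 0 = a. Proof. by rewrite mxE eqxx. Qed.
Lemma pt_1 a b : pt a b 0 1 = b. Proof. by rewrite mxE. Qed.

Lemma pt01_neq0 : pt 0 1 != 0.
Proof. by rewrite row2_neq0 pt_1 oner_eq0 orbT. Qed.

Lemma pt10_neq0 : pt 1 0 != 0.
Proof. by rewrite row2_neq0 pt_0 oner_eq0. Qed.

Lemma line_pt01 : line (pt 0 1) = - 'X_0.
Proof. by rewrite /line pt_0 pt_1 scale0r scale1r sub0r. Qed.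

Lemma line_pt10 : line (pt 1 0) = 'X_1.
Proof. by rewrite /line pt_0 pt_1 scale0r scale1r subr0. Qed.

Lemma line_neq0 p : p != 0 -> line p != 0.
Proof.
rewrite row2_neq0 => /orP[] n0; apply/eqP => l0.
  have := meval_line p (pt 0 1); rewrite l0 meval0 pt_0 pt_1 mulr0 subr0 mulr1.
  by move=> e; rewrite -e eqxx in n0.
have := meval_line p (pt 1 0); rewrite l0 meval0 pt_0 pt_1 mulr0 sub0r mulr1.
by move/esym/eqP; rewrite oppr_eq0 (negPf n0).
Qed.

Lemma meval_scale r h c p : h \is r.-homog -> h.@[(c *: p) 0] = c ^+ r * h.@[p 0].
Proof.
move/dehomogK <-; rewrite !meval_bform mulr_sumr; apply: eq_bigr => i _.
have le: (i <= r)%N by rewrite -ltnS.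
have ->: c ^+ r = c ^+ (r - i) * c ^+ i by rewrite -exprD subnK.
by rewrite !mxE !exprMn; ring.
Qed.

Lemma line_root p q : p != 0 -> q != 0 -> (line p).@[q 0] = 0 ->
  exists2 c, c != 0 & q = c *: p.
Proof.
move=> p0 q0; rewrite meval_line => /eqP; rewrite subr_eq0 => /eqP e.
have [c qc]: exists c, q = c *: p.
  have row2 (u v : 'rV[C]_2) : u 0 0 = v 0 0 -> u 0 1 = v 0 1 -> u = v.
    move=> e0 e1; apply/rowP => -[[|[|//]] lt].
      by rewrite (_ : Ordinal lt = 0) //; apply: val_inj.
    by rewrite (_ : Ordinal lt = 1) //; apply: val_inj.
  have [z|nz] := eqVneq (p 0 0) 0.
    have p1: p 0 1 != 0 by move: p0; rewrite row2_neq0 z eqxx.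
    have q00: q 0 0 = 0.
      by move/eqP: e; rewrite z mul0r eq_sym mulf_eq0 (negPf p1) => /eqP.
    exists (q 0 1 / p 0 1); apply: row2; rewrite mxE ?z ?mulr0 //.
    by rewrite mulfVK.
  exists (q 0 0 / p 0 0); apply: row2; rewrite mxE ?mulfVK //.
  by apply: (mulfI nz); rewrite e; field.
by exists c => //; apply: contraNneq q0 => c0; rewrite qc c0 scale0r.
Qed.

Lemma form_neq0_coef r h : h != 0 -> h \is r.-homog -> dehomog r h != 0.
Proof. by move=> h0 /dehomogK; apply: contra_eq_neq => ->; rewrite linear0 eq_sym. Qed.

Lemma form_nonroot r h : h != 0 -> h \is r.-homog ->
  exists2 q : 'rV[C]_2, q 0 0 != 0 & h.@[q 0] != 0.
Proof.
move=> h0 hh; have f0 := form_neq0_coef h0 hh.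
have [t rt]: exists t : C, ~~ root (dehomog r h) t.
  (* The dehomogenization has at most r roots, fewer than the integers 0, ..., r, which are distinct
     in characteristic 0. *)
  have [n] : exists n : nat, ~~ root (dehomog r h) n%:R.
    have := max_poly_roots (rs := [seq i%:R | i <- iota 0 r.+1]) f0.
    rewrite size_map size_iota.
    case: (boolP (all (root (dehomog r h)) _)) => [_|/allPn[x /mapP[i _ ->]]]; last by exists i.
    rewrite map_inj_uniq ?iota_uniq => [/(_ isT isT)|]; last first.
      by move=> a b /eqP; rewrite Num.Theory.eqr_nat => /eqP.
    by rewrite ltnNge size_dehomog.
  by exists n%:R.
exists (pt 1 t); first by rewrite pt_0 oner_eq0.
rewrite -(dehomogK hh) meval_bform; apply: contra rt => /eqP e; apply/rootP.
rewrite (horner_coef_wide _ (size_dehomog r h)) -[RHS]e; apply: eq_bigr => i _.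
by rewrite pt_0 pt_1 expr1n mul1r.
Qed.

Lemma form_root r h : h != 0 -> h \is r.+1.-homog ->
  exists2 p : 'rV[C]_2, p != 0 & h.@[p 0] = 0.
Proof.
move=> h0 hh; have f0 := form_neq0_coef h0 hh.
(* A vanishing top coefficient is a root at (0 : 1); otherwise the dehomogenization has positive
   degree and a root in the chart. *)
have [fr|fr] := eqVneq (dehomog r.+1 h)`_r.+1 0.
  exists (pt 0 1); first exact: pt01_neq0.
  rewrite -(dehomogK hh) meval_bform big_ord_recr /= fr mul0r addr0 big1 // => i _.
  by rewrite pt_0 subSn 1?expr0n ?mul0r ?mulr0 // -ltnS.
have sf: size (dehomog r.+1 h) = r.+2.
  by apply/eqP; rewrite eqn_leq size_dehomog ltnNge; apply: contra fr => /leq_sizeP ->.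
have [|t rt] := closed_rootP (dehomog r.+1 h) _; first by rewrite sf.
exists (pt 1 t); first by rewrite row2_neq0 pt_0 oner_eq0.
rewrite -(dehomogK hh) meval_bform; move/rootP: rt => rt; rewrite -[RHS]rt.
rewrite (horner_coef_wide _ (size_dehomog r.+1 h)); apply: eq_bigr => i _.
by rewrite pt_0 pt_1 expr1n mul1r.
Qed.

Lemma form_factor r h p : p != 0 -> h != 0 -> h \is r.-homog ->
  exists e z, [/\ (e <= r)%N, z \is (r - e).-homog, z.@[p 0] != 0
                 & h = line p ^+ e * z].
Proof.
move=> p0; elim: r h => [|r IH] h h0 hh.
  exists 0%N, h; split; rewrite ?expr0 ?mul1r //.
  by case/form0_const: hh h0 => c ->; rewrite mpolyC_eq0 mevalC.
have [hp|hp] := eqVneq h.@[p 0] 0; last by exists 0%N, h; rewrite subn0 mul1r.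
have [h' hh' eh] := root_line p0 hh hp.
have h'0: h' != 0 by apply: contraNneq h0 => e; rewrite eh e mulr0.
have [e [z [le hz zp ez]]] := IH h' h'0 hh'.
by exists e.+1, z; split; rewrite ?subSS ?eh ?ez ?exprS ?mulrA.
Qed.

(** The factor [h] is a unit at [p], so all of [line p ^+ e] divides [g]. For e > r the truncated
    degree r - e says nothing; the final disjunction records that g is then zero. *)
Lemma line_pow_dvd r e u g h p : p != 0 -> g \is r.-homog -> h.@[p 0] != 0 ->
  line p ^+ e * u = g * h ->
  exists2 g', g' \is (r - e).-homog & g = line p ^+ e * g' /\ (g == 0) || (e <= r)%N.
Proof.
move=> p0 + hp; elim: e r g => [|e IH] r g gh eq.
  by exists g; rewrite ?subn0 // mul1r orbT.
have [->|g0] := eqVneq g 0; first by exists 0; rewrite ?rpred0 // mulr0.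
have gp: g.@[p 0] = 0.
  have: (g * h).@[p 0] = 0 by rewrite -eq exprS -mulrA mevalM line_self mul0r.
  by rewrite mevalM => /eqP; rewrite mulf_eq0 (negPf hp) orbF => /eqP.
case: r gh => [|r] gh.
  by case/form0_const: gh gp g0 => c ->; rewrite mevalC mpolyC_eq0 => ->; rewrite eqxx.
have [g1 g1h eg] := root_line p0 gh gp.
have [|g' g'h [eg' or]] := IH r g1 g1h.
  by apply: (mulfI (line_neq0 p0)); rewrite !mulrA -eg -exprS.
exists g'; rewrite ?subSS //; split; first by rewrite eg eg' exprS mulrA.
by case/orP: or => [/eqP e0|]; rewrite ?ltnS // eg e0 mulr0 eqxx in g0 *.
Qed.

(** If a monomial X_0^(r-i) X_1^i has i < b, then r - i >= a; so each monomial is divisible by X_0^a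
    or by X_1^b. *)
Lemma form_split r a b g : g \is r.-homog -> (a + b <= r.+1)%N ->
  exists A B, [/\ A \is (r - a).-homog, B \is (r - b).-homog
                 & g = A * 'X_0 ^+ a + B * 'X_1 ^+ b].
Proof.
move=> gh ab; rewrite -(dehomogK gh) /bform.
apply: (big_ind (fun g => exists A B, [/\ A \is (r - a).-homog, B \is (r - b).-homog
                 & g = A * 'X_0 ^+ a + B * 'X_1 ^+ b])).
- by exists 0, 0; rewrite !rpred0 !mul0r addr0.
- move=> _ _ [A [B [hA hB ->]]] [A' [B' [hA' hB' ->]]].
  by exists (A + A'), (B + B'); rewrite !rpredD //; split => //; ring.
- move=> i _; set c := _`_i; have le: (i <= r)%N by rewrite -ltnS.
  have [lb|lb] := leqP b i.
    exists 0, (c *: binary_monomial C (r - b) (i - b)); split; rewrite ?rpred0 //.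
      by rewrite rpredZ // binary_monomialE dhomogX /= mdeg_mon2; lia.
    rewrite mul0r add0r -scalerAl; congr (_ *: _); rewrite /binary_monomial.
    by rewrite -mulrA -exprD; congr (_ ^+ _ * _ ^+ _); lia.
  exists (c *: binary_monomial C (r - a) i), 0; split; rewrite ?rpred0 //.
    by rewrite rpredZ // binary_monomialE dhomogX /= mdeg_mon2; lia.
  rewrite mul0r addr0 -scalerAl; congr (_ *: _); rewrite /binary_monomial.
  by rewrite mulrAC -exprD; congr (_ ^+ _ * _ ^+ _); lia.
Qed.

End BinaryForms.

(** * Stalks of O(m) and principal parts *)

Section FieldIdentities.
Variable F : fieldType.

Lemma addf_frac (a b c d : F) : b != 0 -> d != 0 -> a / b + c / d = (a * d + c * b) / (b * d).
Proof. by move=> b0 d0; field; rewrite b0 d0. Qed.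

Lemma subf_frac (a b c d : F) : b != 0 -> d != 0 -> a / b - c / d = (a * d - c * b) / (b * d).
Proof. by move=> b0 d0; field; rewrite b0 d0. Qed.

Lemma eqf_frac (a b c d : F) : b != 0 -> d != 0 -> a / b = c / d <-> a * d = c * b.
Proof.
move=> b0 d0; split=> [/eqP|e]; last by apply/eqP; rewrite eqr_div // e.
by rewrite eqr_div // => /eqP.
Qed.

Lemma subr_regroup (x y z t : F) : x - y - z = x - (t + (z + y)) + t.
Proof. by ring. Qed.

End FieldIdentities.

Section Stalks.
Variable C : numClosedFieldType.
Local Notation form := {mpoly C[2]}.
Local Notation K := {fraction form}.
Local Notation "x %:F" := (FracField.tofrac x).
Implicit Types (g h z A B G P : form) (p q : 'rV[C]_2) (r t : nat) (m : int) (phi psi : K).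

Lemma tofracXE g e : (g ^+ e)%:F = g%:F ^+ e.
Proof. exact: tofracXn. Qed.

Lemma tofrac_neq0 h : h != 0 -> h%:F != 0.
Proof. by rewrite tofrac_eq0. Qed.

Lemma meval_neq0 h p : h.@[p 0] != 0 -> h != 0.
Proof. by apply: contraNneq => ->; rewrite meval0. Qed.

Lemma tofrac_meval_neq0 h p : h.@[p 0] != 0 -> h%:F != 0.
Proof. by move/meval_neq0; apply: tofrac_neq0. Qed.

Lemma X_neq0 (i : 'I_2) : ('X_i : form) != 0.
Proof.
apply/eqP => /(congr1 (meval (fun=> 1))); rewrite mevalXU meval0.
by apply/eqP; rewrite oner_eq0.
Qed.

Lemma X0n_neq0 e : ('X_0 ^+ e : form) != 0.
Proof. by rewrite expf_neq0 ?X_neq0. Qed.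

Lemma X1n_neq0 e : ('X_1 ^+ e : form) != 0.
Proof. by rewrite expf_neq0 ?X_neq0. Qed.

Lemma X01n_neq0 e : (('X_0 * 'X_1) ^+ e : form) != 0.
Proof. by rewrite expf_neq0 ?mulf_neq0 ?X_neq0. Qed.

Lemma tofrac_eqdiv (a b c d : form) : b != 0 -> d != 0 ->
  a%:F / b%:F = c%:F / d%:F <-> a * d = c * b.
Proof.
move=> b0 d0; rewrite eqf_frac ?tofrac_neq0 // -!tofracM.
by split=> [/eqP|->//]; rewrite tofrac_eq => /eqP.
Qed.

Lemma tofrac_adddiv (a b c d : form) : b != 0 -> d != 0 ->
  a%:F / b%:F + c%:F / d%:F = (a * d + c * b)%:F / (b * d)%:F.
Proof. by move=> b0 d0; rewrite addf_frac ?tofrac_neq0 // -!tofracM -tofracD. Qed.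

Lemma tofrac_subdiv (a b c d : form) : b != 0 -> d != 0 ->
  a%:F / b%:F - c%:F / d%:F = (a * d - c * b)%:F / (b * d)%:F.
Proof. by move=> b0 d0; rewrite subf_frac ?tofrac_neq0 // -!tofracM -tofracB. Qed.

Lemma O_stalk_form r g p : g \is r.-homog -> O_stalk r p g%:F.
Proof.
move=> hg; exists r, 0%N, g, 1; split=> //; first exact: dhomog1.
- by rewrite subr0.
- by rewrite meval1 oner_eq0.
- by rewrite tofrac1 divr1.
Qed.

Lemma O_stalk_inv t h p : h \is t.-homog -> h.@[p 0] != 0 -> O_stalk (- t%:Z) p (h%:F)^-1.
Proof.
move=> hh hp; exists 0%N, t, 1, h; split=> //; first exact: dhomog1.
- by rewrite sub0r.
- by rewrite tofrac1 div1r.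
Qed.

Lemma O_stalkM m m' p phi psi :
  O_stalk m p phi -> O_stalk m' p psi -> O_stalk (m + m') p (phi * psi).
Proof.
move=> [r [t [g [h [hg hh e hp ->]]]]] [r' [t' [g' [h' [hg' hh' e' hp' ->]]]]].
exists (r + r')%N, (t + t')%N, (g * g'), (h * h'); split; try exact: dhomogM.
- by rewrite -e -e'; lia.
- by rewrite mevalM mulf_neq0.
- by rewrite !tofracM mulf_div.
Qed.

Lemma O_stalkM_eq m m' m'' p phi psi : O_stalk m p phi -> O_stalk m' p psi ->
  m + m' = m'' -> O_stalk m'' p (phi * psi).
Proof. by move=> h h' <-; apply: O_stalkM. Qed.

Lemma O_stalkD m p phi psi : O_stalk m p phi -> O_stalk m p psi -> O_stalk m p (phi + psi).
Proof.
move=> [r [t [g [h [hg hh e hp ->]]]]] [r' [t' [g' [h' [hg' hh' e' hp' ->]]]]].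
exists (r + t')%N, (t + t')%N, (g * h' + g' * h), (h * h'); split.
- apply: rpredD; first exact: dhomogM.
  rewrite (_ : (r + t')%N = (r' + t)%N); first exact: dhomogM.
  by move: e e'; lia.
- exact: dhomogM.
- by rewrite -e; lia.
- by rewrite mevalM mulf_neq0.
- by rewrite tofracD !tofracM addf_frac // (tofrac_meval_neq0 (p := p)).
Qed.

Lemma O_stalkN m p phi : O_stalk m p phi -> O_stalk m p (- phi).
Proof.
move=> [r [t [g [h [hg hh e hp ->]]]]].
by exists r, t, (- g), h; split; rewrite ?rpredN // tofracN mulNr.
Qed.

Lemma O_stalkB m p phi psi : O_stalk m p phi -> O_stalk m p psi -> O_stalk m p (phi - psi).
Proof. by move=> h /O_stalkN; apply: O_stalkD. Qed.

Lemma int_sub_nat m : exists r t : nat, r%:Z - t%:Z = m.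
Proof.
case: m => n; first by exists n, 0%N; rewrite subr0.
by exists 0%N, n.+1; rewrite sub0r NegzE.
Qed.

Lemma O_stalk0 m p : p != 0 -> O_stalk m p 0.
Proof.
move=> p0; have [r [t e]] := int_sub_nat m.
have [i pi] : exists i, p 0 i != 0.
  by move: p0; rewrite row2_neq0 => /orP[]; [exists 0 | exists 1].
exists r, t, 0, ('X_i ^+ t); split; rewrite ?rpred0 ?var_homog //.
  by rewrite rmorphXn /= mevalXU expf_neq0.
by rewrite tofrac0 mul0r.
Qed.

Lemma O_stalk_cst m p c phi : O_stalk m p phi -> O_stalk m p (cst c * phi).
Proof.
move=> h; apply: O_stalkM_eq h _ => //; last first.
  exact: add0r.
by apply: (@O_stalk_form 0%N); rewrite -[c%:MP]mulr1 mul_mpolyC rpredZ // dhomog1.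
Qed.

Lemma O_stalk_sum m p (I : Type) (s : seq I) (f : I -> K) : p != 0 ->
  (forall i, O_stalk m p (f i)) -> O_stalk m p (\sum_(i <- s) f i).
Proof.
move=> p0 H; elim/big_rec: _ => [|i x _ hx]; first exact: O_stalk0.
exact: O_stalkD.
Qed.

Lemma O_stalk_scale m p c phi : c != 0 -> O_stalk m p phi -> O_stalk m (c *: p) phi.
Proof.
move=> c0 [r [t [g [h [hg hh e hp ->]]]]]; exists r, t, g, h; split=> //.
by rewrite (meval_scale _ _ hh) mulf_neq0 // expf_neq0.
Qed.

Definition O_generic m phi := exists r t g h,
  [/\ g \is r.-homog, h \is t.-homog, r%:Z - t%:Z = m, h != 0 & phi = g%:F / h%:F].

Lemma O_stalk_rat m p phi : O_stalk m p phi -> O_generic m phi.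
Proof.
move=> [r [t [g [h [hg hh e hp ->]]]]]; exists r, t, g, h; split=> //.
exact: meval_neq0 hp.
Qed.

Lemma root_line_pred r h p : p != 0 -> h \is r.-homog -> h.@[p 0] = 0 ->
  exists2 h', h' \is r.-1.-homog & h = line p * h'.
Proof.
case: r => [|r] p0 hh hp; last exact: root_line.
exists 0; first exact: rpred0.
by case/form0_const: hh hp => c ->; rewrite mevalC mulr0 => ->; rewrite mpolyC0.
Qed.

Lemma frac_sub_inverse (g a z w l y : form) : a != 0 -> z != 0 -> l != 0 ->
  a * y = l - z * w ->
  g%:F / (a * z)%:F - (g * w)%:F / (a * l)%:F = (g * y)%:F / (z * l)%:F.
Proof.
move=> a0 z0 l0 e; rewrite tofrac_subdiv ?mulf_neq0 //.
apply/tofrac_eqdiv; rewrite ?mulf_neq0 //.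
transitivity (g * a * (l - z * w) * z * l); first by ring.
by rewrite -e; ring.
Qed.

(* If [l ^+ t - c * z] vanishes at [p], it is a multiple [line p * y], and      *)
(* [l ^+ (t * e) = z * z' + (line p * y) ^+ e] inverts [z] modulo [line p ^+ e]. *)
Lemma strong_approx p l m phi : p != 0 -> l \is 1.-homog -> l.@[p 0] != 0 ->
  O_generic m phi -> exists e f r g, [/\ g \is r.-homog, r%:Z - (e + f)%:Z = m
    & O_stalk m p (phi - g%:F / (line p ^+ e * l ^+ f)%:F)].
Proof.
move=> p0 hl lp [r [t [g [h [hg hh em h0 ->]]]]].
have [e [z [let_ hz zp eh]]] := form_factor p0 h0 hh.
have z0: z%:F != 0 by apply: tofrac_meval_neq0 zp.
have l0: l%:F != 0 by apply: tofrac_meval_neq0 lp.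
have n0: (line p)%:F != 0 by apply: tofrac_neq0; apply: line_neq0.
case: e let_ hz eh => [|e] let_ hz eh.
  exists 0%N, t, r, 0; split; rewrite ?rpred0 //.
  by rewrite tofrac0 mul0r subr0 eh mul1r; exists r, t, g, z; split; rewrite // -[t]subn0.
set s := (t - e.+1)%N in hz.
have hls: l ^+ s \is s.-homog by rewrite -[s in s.-homog]mul1n; apply: dhomogMn.
pose c := l.@[p 0] ^+ s / z.@[p 0].
have [||y hy ey] := @root_line_pred s (l ^+ s - c *: z) p p0.
- by rewrite rpredB ?rpredZ.
- by rewrite mevalB mevalZ rmorphXn /= /c mulfVK // subrr.
pose w := \sum_(i < e.+1) (l ^+ s) ^+ (e.+1.-1 - i) * (line p * y) ^+ i.
have hly: line p * y \is s.-homog by rewrite -ey rpredB ?rpredZ.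
have hw: w \is (s * e)%N.-homog.
  apply: rpred_sum => i _; have le: (i <= e)%N by rewrite -ltnS.
  rewrite (_ : (s * e)%N = (s * (e - i) + s * i)%N); last by rewrite -mulnDr subnK.
  by apply: dhomogM; apply: dhomogMn.
have ew: (l ^+ s) ^+ e.+1 - (line p * y) ^+ e.+1 = z * (c *: w).
  rewrite subrXX -/w (_ : l ^+ s - _ = c *: z); first by rewrite -scalerAr scalerAl.
  by rewrite -ey opprB addrCA subrr addr0.
exists e.+1, (s * e.+1)%N, (r + s * e)%N, (g * (c *: w)); split.
- by rewrite dhomogM ?rpredZ.
- by rewrite -em /s; move: let_; clear; lia.
have -> : g%:F / h%:F - (g * (c *: w))%:F / (line p ^+ e.+1 * l ^+ (s * e.+1))%:F
          = (g * y ^+ e.+1)%:F / (z * l ^+ (s * e.+1))%:F.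
  have {ew} ew: (line p * y) ^+ e.+1 = (l ^+ s) ^+ e.+1 - z * (c *: w).
    by rewrite -ew opprB addrCA subrr addr0.
  rewrite {1}eh; apply: frac_sub_inverse; rewrite ?expf_neq0 ?line_neq0 ?(meval_neq0 lp)
    ?(meval_neq0 zp) //.
  by move: ew; rewrite -exprM exprMn.
(* For s = 0 the degree [s.-1] of y is off by one. But then z is a constant, c z = 1, and y = 0. *)
case: (posnP s) => [s0|s_gt].
  suff ->: y = 0 by rewrite expr0n mulr0 tofrac0 mul0r; apply: O_stalk0.
  apply/eqP; rewrite -(inj_eq (mulfI (line_neq0 p0))) mulr0 -ey /c s0 !expr0 div1r.
  rewrite s0 in hz; case/form0_const: hz => d ez; rewrite ez mevalC -mul_mpolyC -mpolyCM mulVf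
    ?subrr //.
  by move: zp; rewrite ez mevalC.
exists (r + s.-1 * e.+1)%N, (s + s * e.+1)%N, (g * y ^+ e.+1), (z * l ^+ (s * e.+1)); split=> //.
- by rewrite dhomogM ?dhomogMn.
- apply: dhomogM => //; rewrite -[X in X.-homog]mul1n; exact: dhomogMn.
- have et: t = (s + e.+1)%N by rewrite subnK.
  by rewrite -em et; move: (s) s_gt; clear; case=> // s' _; lia.
- by rewrite mevalM rmorphXn mulf_neq0 ?expf_neq0.
Qed.

Lemma X0_pow_dvd r e u g h : g \is r.-homog -> h.@[(pt 0 1 : 'rV[C]_2) 0] != 0 ->
  'X_0 ^+ e * u = g * h ->
  exists2 g', g' \is (r - e).-homog & g = 'X_0 ^+ e * g' /\ (g == 0) || (e <= r)%N.
Proof.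
move=> hg hh eq; have [|g' hg' [eg' o]] := @line_pow_dvd C r e ((-1) ^+ e * u) g h (pt 0 1)
  (pt01_neq0 C) hg hh.
  rewrite line_pt01 (exprNn 'X_0) -eq.
  transitivity ((-1) ^+ e * (-1) ^+ e * ('X_0 ^+ e * u)); first by ring.
  by rewrite -exprMn mulrNN mulr1 expr1n mul1r.
exists ((-1) ^+ e * g'); first by case/orP: (orbN (odd e)) => h1;
  rewrite -signr_odd ?h1 ?(negPf h1) ?mul1r // mulN1r rpredN.
by split=> //; rewrite {1}eg' line_pt01 (exprNn 'X_0); ring.
Qed.

Lemma X1_pow_dvd r e u g h : g \is r.-homog -> h.@[(pt 1 0 : 'rV[C]_2) 0] != 0 ->
  'X_1 ^+ e * u = g * h ->
  exists2 g', g' \is (r - e).-homog & g = 'X_1 ^+ e * g' /\ (g == 0) || (e <= r)%N.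
Proof. by rewrite -line_pt10; apply: line_pow_dvd; apply: pt10_neq0. Qed.

(** Induction on the degree of the part h of the denominator besides X_0^N. A root of h on X_0 = 0
    gives one more factor X_0; at any other root p regularity forces [line p] to divide the
    numerator too, and it cancels. *)
Lemma chart0_regular m phi : (forall q, q 0 0 != 0 -> O_stalk m q phi) ->
  exists N r A, [/\ A \is r.-homog, r%:Z - N%:Z = m & phi = A%:F / ('X_0 ^+ N)%:F].
Proof.
move=> reg.
suff H t N r g h : g \is r.-homog -> h \is t.-homog -> r%:Z - (N + t)%:Z = m ->
    h != 0 -> phi = g%:F / ('X_0 ^+ N * h)%:F ->
    exists N r A, [/\ A \is r.-homog, r%:Z - N%:Z = m & phi = A%:F / ('X_0 ^+ N)%:F].
  have [|r [t [g [h [hg hh em hp e]]]]] := reg (pt 1 0); first by rewrite pt_0 oner_eq0.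
  by apply: (H t 0%N r g h) => //; rewrite ?mul1r // (meval_neq0 hp).
elim: t N r g h => [|t IH] N r g h hg hh em h0 e.
  case/form0_const: hh h0 e => c ->; rewrite mpolyC_eq0 => c0 e.
  exists N, r, (c^-1 *: g); split; rewrite ?rpredZ //; first by rewrite -em addn0.
  rewrite e; apply/tofrac_eqdiv; rewrite ?mulf_neq0 ?X0n_neq0 ?mpolyC_eq0 //.
  rewrite mulrCA [_ * c%:MP]mulrC mul_mpolyC.
  by rewrite scalerA mulfV // scale1r mulrC.
have [p p0 hp] := form_root h0 hh; have [h1 hh1 eh] := root_line p0 hh hp.
have h10: h1 != 0 by apply: contraNneq h0 => z; rewrite eh z mulr0.
have [p00|p00] := eqVneq (p 0 0) 0.
  apply: (IH N.+1 r g (- p 0 1 *: h1)) => //.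
  - by rewrite rpredZ.
  - by rewrite -em; lia.
  - rewrite scaler_eq0 oppr_eq0 (negPf h10) orbF.
    by move: p0; rewrite row2_neq0 p00 eqxx.
  - rewrite e eh; congr (_ / _%:F); rewrite /line p00 scale0r sub0r exprSr -!mulrA.
    by congr (_ * _); rewrite -scalerAr -scaleNr -scalerAl.
have [r' [t' [g' [h' [hg' hh' em' hp' e']]]]] := reg p p00.
have eq: line p ^+ 1 * ('X_0 ^+ N * h1 * g') = g * h'.
  move: e'; rewrite {1}e => /tofrac_eqdiv ->; last exact: meval_neq0 hp'.
    by rewrite eh; ring.
  by rewrite mulf_neq0 ?X0n_neq0.
have [g1 hg1 [eg o]] := line_pow_dvd p0 hg hp' eq.
have [g0|g0] := eqVneq g 0.
  have [r1 [t1 e1]] := int_sub_nat m.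
  by exists t1, r1, 0; rewrite rpred0 tofrac0 mul0r e g0 tofrac0 mul0r.
apply: (IH N (r - 1)%N g1 h1) => //; first by move: o; rewrite (negPf g0) /= -em; clear; lia.
rewrite e eh eg; apply/tofrac_eqdiv; rewrite ?mulf_neq0 ?X0n_neq0 ?line_neq0 //.
by ring.
Qed.

(** * Cocycles of O(n) for the cover X_0 <> 0, X_1 <> 0 *)

Local Notation oo := (pt 0 1 : 'rV[C]_2).

(** Z is the numerator over the common denominator X_0^N X_1^E. As X_1 is a unit at (0 : 1),
    regularity there means that X_0^N divides Z. *)
Lemma cousin_numerator N E v s A G u h :
  A \is v.-homog -> G \is s.-homog -> (v + 2 * E)%N = (s + N)%N ->
  (E <= N)%N -> h.@[oo 0] != 0 ->
  A%:F / ('X_0 ^+ N)%:F - G%:F / (('X_0 * 'X_1) ^+ E)%:F = u%:F / h%:F ->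
  let Z := A * 'X_1 ^+ E - G * 'X_0 ^+ (N - E) in
  exists2 B, B \is (v + E - N)%N.-homog & Z = 'X_0 ^+ N * B /\ (Z == 0) || (N <= v + E)%N.
Proof.
move=> hA hG eas EN hoo eq Z.
have hZ : Z \is (v + E).-homog.
  apply: rpredB; first by apply: dhomogM => //; apply: var_homog.
  by rewrite (_ : (v + E)%N = (s + (N - E))%N); [apply: dhomogM => //;
    apply: var_homog | move: eas EN; clear; lia].
apply: (@X0_pow_dvd (v + E) N ('X_1 ^+ E * u) Z h hZ hoo); move: eq.
have eN: ('X_0 ^+ N : form) = 'X_0 ^+ (N - E) * 'X_0 ^+ E by rewrite -exprD subnK.
rewrite exprMn tofrac_subdiv ?mulf_neq0 ?X0n_neq0 ?X1n_neq0 //.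
move/tofrac_eqdiv => H.
have {}H := H (mulf_neq0 (X0n_neq0 _) (mulf_neq0 (X0n_neq0 _) (X1n_neq0 _))) (meval_neq0 hoo).
apply: (mulfI (X0n_neq0 E)).
transitivity (u * ('X_0 ^+ N * ('X_0 ^+ E * 'X_1 ^+ E))); first by ring.
by rewrite -H /Z eN; ring.
Qed.

(** A cocycle that is a coboundary splits without raising the exponent E: from Z = X_0^N B one gets
    A X_1^E = X_0^(N-E) (G + X_0^E B), and X_0^(N-E) divides A. *)
Lemma cousin_regular n N E v s A G : A \is v.-homog -> G \is s.-homog ->
  v%:Z - N%:Z = n -> s%:Z - (2 * E)%:Z = n -> (E <= s)%N ->
  O_stalk n oo (A%:F / ('X_0 ^+ N)%:F - G%:F / (('X_0 * 'X_1) ^+ E)%:F) ->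
  exists A' B, [/\ A' \is (s - E).-homog, B \is (s - E).-homog,
    G = A' * 'X_1 ^+ E + B * 'X_0 ^+ E & A%:F / ('X_0 ^+ N)%:F = A'%:F / ('X_0 ^+ E)%:F].
Proof.
move=> hA hG ea es Es.
(* The fraction is expanded by X_0^E so that the exponent of the denominator is at least E, as
   [cousin_numerator] requires. *)
have -> : A%:F / ('X_0 ^+ N)%:F = (A * 'X_0 ^+ E)%:F / ('X_0 ^+ (N + E))%:F.
  apply/tofrac_eqdiv; rewrite ?X0n_neq0 //.
  by rewrite exprD; ring.
have {hA} : A * 'X_0 ^+ E \is (v + E).-homog by apply: dhomogM => //; apply: var_homog.
have {N v ea} [v' [N' [-> -> ENN ea]]] : exists v' N', [/\ (v + E)%N = v', (N + E)%N = N', (E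
  <= N')%N & v'%:Z - N'%:Z = n].
  by exists (v + E)%N, (N + E)%N; split; move: ea; clear; lia.
move: (A * _) => {}A hA [r [t [g [h [hg hh e hp eq]]]]].
have [|B hB [eB _]] := @cousin_numerator N' E v' s A G g h hA hG _ ENN hp eq.
  by move: ea es ENN; clear; lia.
have [||A' hA' [eA _]] := @X0_pow_dvd v' (N' - E) (G + 'X_0 ^+ E * B) A ('X_1 ^+ E) hA.
- by rewrite rmorphXn /= mevalXU pt_1 expf_neq0 ?oner_eq0.
- rewrite mulrDr mulrA -exprD subnK // -eB; ring.
have eE: (v' - (N' - E))%N = (s - E)%N by move: ea es ENN; clear; lia.
exists A', (- B); split.
- by rewrite -eE.
- by rewrite rpredN (_ : (s - E)%N = (v' + E - N')%N) //; move: ea es ENN Es; clear; lia.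
- apply: (mulfI (X0n_neq0 (N' - E))); apply/eqP.
  rewrite -subr_eq0; apply/eqP.
  have eN: ('X_0 ^+ N' : form) = 'X_0 ^+ (N' - E) * 'X_0 ^+ E by rewrite -exprD subnK.
  transitivity ('X_0 ^+ N' * B - (A * 'X_1 ^+ E - G * 'X_0 ^+ (N' - E))).
    by rewrite eA eN; ring.
  by rewrite eB subrr.
- apply/tofrac_eqdiv; rewrite ?X0n_neq0 //.
  by rewrite eA -[in RHS](subnK ENN) exprD; ring.
Qed.

(** Here Z has degree smaller than the exponent of X_0 dividing it, so Z = 0. Then X_1^E divides G,
    whose degree is below E. *)
Lemma cousin_injective n N E v s A G : A \is v.-homog -> G \is s.-homog ->
  v%:Z - N%:Z = n -> s%:Z - (2 * E)%:Z = n -> (s < E)%N ->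
  O_stalk n oo (A%:F / ('X_0 ^+ N)%:F - G%:F / (('X_0 * 'X_1) ^+ E)%:F) -> G = 0.
Proof.
move=> hA hG ea es Es.
have -> : A%:F / ('X_0 ^+ N)%:F = (A * 'X_0 ^+ E)%:F / ('X_0 ^+ (N + E))%:F.
  apply/tofrac_eqdiv; rewrite ?X0n_neq0 //.
  by rewrite exprD; ring.
have {hA} : A * 'X_0 ^+ E \is (v + E).-homog by apply: dhomogM => //; apply: var_homog.
have {N v ea} [v' [N' [-> -> ENN ea]]] : exists v' N', [/\ (v + E)%N = v', (N + E)%N = N', (E
  <= N')%N & v'%:Z - N'%:Z = n].
  by exists (v + E)%N, (N + E)%N; split; move: ea; clear; lia.
move: (A * _) => {}A hA [r [t [g [h [hg hh e hp eq]]]]].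
have [|B hB [eB o]] := @cousin_numerator N' E v' s A G g h hA hG _ ENN hp eq.
  by move: ea es ENN; clear; lia.
have Z0: A * 'X_1 ^+ E - G * 'X_0 ^+ (N' - E) = 0.
  by case/orP: o => [/eqP//|]; move: ea es Es; clear; lia.
have [||G' hG' [eG o']] := @X1_pow_dvd s E A G ('X_0 ^+ (N' - E)) hG.
- by rewrite rmorphXn /= mevalXU pt_0 expf_neq0 ?oner_eq0.
- by apply/eqP; rewrite mulrC -subr_eq0 Z0.
by case/orP: o' => [/eqP//|]; rewrite leqNgt Es.
Qed.

(* H^1 of O(- D - 2) consists of the classes of P / (X_0 X_1)^(D + 1), deg P = D. *)
Lemma cousin_surjective D phi : O_generic (- D.+2%:Z) phi ->
  exists P b, [/\ P \is D.-homog,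
    forall q, q 0 0 != 0 -> O_stalk (- D.+2%:Z) q b
    & O_stalk (- D.+2%:Z) oo (phi - P%:F / (('X_0 * 'X_1) ^+ D.+1)%:F - b)].
Proof.
move=> Hphi; have x1: ('X_1 : form).@[oo 0] != 0 by rewrite mevalXU pt_1 oner_eq0.
have h1: ('X_1 : form) \is 1.-homog by rewrite -['X_1]expr1 var_homog.
have [e [f [r [g [hg er reg]]]]] := strong_approx (pt01_neq0 C) h1 x1 Hphi.
(* G is the numerator over the denominator (X_0 X_1)^N, and N is large enough for both splittings
   below. The sign compensates [line oo] = - X_0. *)
pose N := (e + f + D.+2)%N; pose G := (-1) ^+ e * (g * 'X_0 ^+ (N - e) * 'X_1 ^+ (N - f)).
have hG: G \is (2 * N - D.+2).-homog.
  have: g * 'X_0 ^+ (N - e) * 'X_1 ^+ (N - f) \is (r + (N - e) + (N - f)).-homog.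
    by do 2!(apply: dhomogM; last exact: var_homog).
  rewrite (_ : (r + (N - e) + (N - f) = 2 * N - D.+2)%N); last by move: er; rewrite /N; clear;
    lia.
  by rewrite /G -signr_odd; case: (odd e); rewrite ?mulN1r ?mul1r ?rpredN.
(* The first splitting removes A / X_1^N, which is regular at (0 : 1); the second removes B / X_0^N,
   which is regular on the chart and becomes [b]. What remains is P / (X_0 X_1)^(D+1). *)
have [|A [G' [hA hG' eG]]] := @form_split C _ N (N - D.+1) G hG.
  by rewrite /N; clear; lia.
have [|P [B [hP hB eG']]] := @form_split C _ (N - D.+1) D.+1 G' hG'.
  by rewrite /N; clear; lia.
exists P, (B%:F / ('X_0 ^+ N)%:F); split.
- by rewrite (_ : D = 2 * N - D.+2 - (N - D.+1) - (N - D.+1))%N // /N; clear; lia.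
- move=> q q0; apply: O_stalkM_eq (O_stalk_form _ hB) (O_stalk_inv (var_homog _ _ N) _) _.
    by rewrite rmorphXn /= mevalXU expf_neq0.
  by rewrite /N; clear; lia.
have -> : phi - P%:F / (('X_0 * 'X_1) ^+ D.+1)%:F - B%:F / ('X_0 ^+ N)%:F =
   (phi - g%:F / (line oo ^+ e * 'X_1 ^+ f)%:F) + A%:F / ('X_1 ^+ N)%:F.
  have -> : g%:F / (line oo ^+ e * 'X_1 ^+ f)%:F = G%:F / (('X_0 * 'X_1) ^+ N)%:F.
    apply/tofrac_eqdiv; rewrite ?X01n_neq0 //.
      by rewrite mulf_neq0 ?X1n_neq0 // expf_neq0 // line_neq0 // pt01_neq0.
    have e0: ('X_0 ^+ N : form) = 'X_0 ^+ (N - e) * 'X_0 ^+ e by rewrite -exprD subnK // /N;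
      clear; lia.
    have e1: ('X_1 ^+ N : form) = 'X_1 ^+ (N - f) * 'X_1 ^+ f by rewrite -exprD subnK // /N;
      clear; lia.
    have s1: (-1) ^+ e * (-1) ^+ e = 1 :> form by rewrite -exprMn mulrNN mulr1 expr1n.
    rewrite exprMn e0 e1 /G line_pt01 (exprNn 'X_0).
    transitivity ((-1) ^+ e * (-1) ^+ e * (g * ('X_0 ^+ (N - e) * 'X_0 ^+ e * ('X_1 ^+ (N - f)
      * 'X_1 ^+ f)))).
      by rewrite s1 mul1r.
    by ring.
  have DN: (D.+1 <= N)%N by rewrite /N; clear; lia.
  have -> : G%:F / (('X_0 * 'X_1) ^+ N)%:F =
    A%:F / ('X_1 ^+ N)%:F + (B%:F / ('X_0 ^+ N)%:F + P%:F / (('X_0 * 'X_1) ^+ D.+1)%:F).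
    rewrite !tofrac_adddiv ?mulf_neq0 ?X01n_neq0 ?X0n_neq0 ?X1n_neq0 //.
    apply/tofrac_eqdiv; rewrite ?mulf_neq0 ?X01n_neq0 ?X0n_neq0 ?X1n_neq0 //.
    have e0: ('X_0 ^+ N : form) = 'X_0 ^+ (N - D.+1) * 'X_0 ^+ D.+1 by rewrite -exprD subnK.
    have e1: ('X_1 ^+ N : form) = 'X_1 ^+ (N - D.+1) * 'X_1 ^+ D.+1 by rewrite -exprD subnK.
    by rewrite eG eG' !exprMn e0 e1; ring.
  exact: subr_regroup.
apply: O_stalkD => //; apply: O_stalkM_eq (O_stalk_form _ hA) (O_stalk_inv (var_homog _ _ N) _) _.
  by rewrite rmorphXn /= mevalXU pt_1 expf_neq0 ?oner_eq0.
by rewrite /N; clear; lia.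
Qed.

End Stalks.

(** * Sections of the cokernel of a matrix of forms *)

Lemma subr_subr (V : zmodType) (x y z : V) : x - y - (x - z) = z - y.
Proof. by rewrite opprB addrC addrA subrK. Qed.

Lemma addr_sub_eq (V : zmodType) (x y z : V) : x = x - y + z -> y = z.
Proof. by rewrite -addrA -{1}[x]addr0 => /addrI /esym /eqP; rewrite addrC subr_eq0 => /eqP. Qed.

Section Cech.
Variable C : numClosedFieldType.
Local Notation form := {mpoly C[2]}.
Local Notation K := {fraction form}.
Local Notation "x %:F" := (FracField.tofrac x).
Implicit Types (p q : 'rV[C]_2).

(** Taking X_0 as the auxiliary linear form sends the additional poles out of the chart. *)
Lemma strong_approx_chart0 p m (phi : K) : p 0 0 != 0 -> O_generic m phi ->
  exists psi, O_stalk m p (phi - psi) /\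
    forall q, q 0 0 != 0 -> (line p).@[q 0] != 0 -> O_stalk m q psi.
Proof.
move=> p00 Hphi; have p0: p != 0 by rewrite row2_neq0 p00.
have h1: ('X_0 : form) \is 1.-homog by rewrite -['X_0]expr1 var_homog.
have [|e [f [r [g [hg er reg]]]]] := strong_approx p0 h1 _ Hphi.
  by rewrite mevalXU.
exists (g%:F / (line p ^+ e * 'X_0 ^+ f)%:F); split=> // q q00 lq.
apply: O_stalkM_eq (O_stalk_form _ hg) (O_stalk_inv (t := e + f) _ _) _.
- apply: dhomogM; last exact: var_homog.
  by rewrite -[e in e.-homog]mul1n; apply: dhomogMn; apply: line_homog.
- by rewrite mevalM !rmorphXn /= mevalXU mulf_neq0 ?expf_neq0.
- exact: er.
Qed.

Variables (rho n : nat) (M : 'M[form]_(rho, n)) (k delta : nat).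
Hypothesis hM : forall r j, M r j \is delta.-homog.
Let MK : 'M[K]_(rho, n) := map_mx (@FracField.tofrac _) M.
Hypothesis Minj : forall b : 'rV[K]_rho, b *m MK = 0 -> b = 0.
Local Notation D := (k + delta)%N.

(* The stalks of the target and of the image of M : O(- D - 2)^rho -> O(- k - 2)^n. *)
Definition free_stalk q (w : 'rV[K]_n) := forall j, O_stalk (- k.+2%:Z) q (w 0 j).
Definition image_stalk q (w : 'rV[K]_n) :=
  exists2 b : 'rV[K]_rho, forall r, O_stalk (- D.+2%:Z) q (b 0 r) & w = b *m MK.

Lemma image_stalk_free q w : q != 0 -> image_stalk q w -> free_stalk q w.
Proof.
move=> q0 [b hb ->] j; rewrite mxE; apply: O_stalk_sum => // r; rewrite mxE.
by apply: O_stalkM_eq (hb r) (O_stalk_form _ (hM r j)) _; lia.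
Qed.

Lemma free_stalkD q w w' : free_stalk q w -> free_stalk q w' -> free_stalk q (w + w').
Proof. by move=> h h' j; rewrite mxE; apply: O_stalkD. Qed.

Lemma free_stalkN q w : free_stalk q w -> free_stalk q (- w).
Proof. by move=> h j; rewrite mxE; apply: O_stalkN. Qed.

Lemma image_stalk0 q : q != 0 -> image_stalk q 0.
Proof. by move=> q0; exists 0; rewrite ?mul0mx // => r; rewrite mxE; apply: O_stalk0. Qed.

Lemma image_stalkD q w w' : image_stalk q w -> image_stalk q w' -> image_stalk q (w + w').
Proof.
move=> [b h ->] [b' h' ->]; exists (b + b'); rewrite ?mulmxDl // => r.
by rewrite mxE; apply: O_stalkD.
Qed.

Lemma image_stalkN q w : image_stalk q w -> image_stalk q (- w).
Proof. by move=> [b h ->]; exists (- b); rewrite ?mulNmx // => r; rewrite mxE;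
  apply: O_stalkN. Qed.

Lemma image_stalkB q w w' : image_stalk q w -> image_stalk q w' -> image_stalk q (w - w').
Proof. by move=> h /image_stalkN; apply: image_stalkD. Qed.

(** The chart is affine and H^1 of O(- D - 2) vanishes on it, so the local lifts of a section of the
    cokernel can be corrected to a single one. *)
Lemma section_chart0 sigma : quotient_section free_stalk image_stalk sigma ->
  exists v, forall q, q 0 0 != 0 -> free_stalk q v /\ image_stalk q (sigma q - v).
Proof.
move=> sec.
(* The bad locus h = 0 is removed point by point: near a root p of h another     *)
(* lift v' exists, and v' - v = b M is approximated at p without new poles.     *)
suff H t h v : h != 0 -> h \is t.-homog ->
    (forall q, q 0 0 != 0 -> h.@[q 0] != 0 -> free_stalk q v /\ image_stalk q (sigma q - v)) ->
    exists v, forall q, q 0 0 != 0 -> free_stalk q v /\ image_stalk q (sigma q - v).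
  have [|r [h [v [hh hp Hv]]]] := sec (pt 1 0); first exact: pt10_neq0.
  apply: (H r h v) => // [|q q0]; first exact: meval_neq0 hp.
  by apply: Hv; rewrite row2_neq0 q0.
have [m] := ubnP t; elim: m => // m IH in t h v * => tm h0 hh Hv.
case: t => [|t] in hh tm.
  case/form0_const: hh h0 Hv => c ->; rewrite mpolyC_eq0 => c0 Hv.
  by exists v => q q0; apply: Hv; rewrite ?mevalC.
have [p p0 hp] := form_root h0 hh.
(* A root outside the chart is harmless: its linear factor is simply dropped from h. *)
have [p00|p00] := eqVneq (p 0 0) 0.
  have [h1 hh1 eh] := root_line p0 hh hp.
  apply: (IH t h1 v) => //; first by apply: contraNneq h0 => e; rewrite eh e mulr0.
  move=> q q0 h1q; apply: Hv => //; rewrite eh mevalM mulf_neq0 // meval_line p00 mul0r sub0r.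
  by rewrite oppr_eq0 mulf_neq0 //; move: p0; rewrite row2_neq0 p00 eqxx.
have [e [z [let_ hz zp eh]]] := form_factor p0 h0 hh.
have e0: (0 < e)%N.
  by rewrite lt0n; apply: contraNneq zp => e0; move: hp; rewrite eh e0 mul1r => ->.
have [r' [h' [v' [hh' hp' Hv']]]] := sec p p0.
have [|q q00] := @form_nonroot C (t.+1 + r') (h * h') _ (dhomogM hh hh').
  by rewrite mulf_neq0 // (meval_neq0 hp').
rewrite mevalM mulf_eq0 negb_or => /andP[hq hq'].
have q0: q != 0 by rewrite row2_neq0 q00.
have [b hb eb]: image_stalk q (v' - v).
  have -> : v' - v = (sigma q - v) - (sigma q - v') by rewrite opprB [RHS]addrC addrA subrK.
  by apply: image_stalkB; [have [] := Hv q q00 hq | have [] := Hv' q q0 hq'].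
have [b' Hb'] := fin_all_exists (fun r => strong_approx_chart0 p00 (O_stalk_rat (hb r))).
pose b1 := \row_r b' r.
(* The corrected lift has two expressions: the left one is good where [line p] and h do not vanish,
   the right one at p, where b - b1 is regular. *)
have ev: v + b1 *m MK = v' - (b - b1) *m MK by rewrite mulmxBl -eb; apply/rowP => j;
  rewrite !mxE; ring.
apply: (IH (t.+1 - e)%N z (v + b1 *m MK)) => //; first by move: tm e0; clear; lia.
  exact: meval_neq0 zp.
move=> x x00 zx; have x0: x != 0 by rewrite row2_neq0 x00.
have [lx|lx] := eqVneq (line p).@[x 0] 0.
  have [c c0 xc] := line_root p0 x0 lx.
  have h'x: h'.@[x 0] != 0 by rewrite xc (meval_scale _ _ hh') mulf_neq0 // expf_neq0.
  have [Ex Sx] := Hv' x x0 h'x; rewrite ev.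
  have Sb: image_stalk x ((b - b1) *m MK).
    exists (b - b1) => // r; rewrite !mxE xc; apply: O_stalk_scale => //.
    by have [] := Hb' r.
  split; first by apply: free_stalkD => //; apply: free_stalkN; apply: image_stalk_free.
  by rewrite opprB addrCA addrC; apply: image_stalkD.
have [|Ex Sx] := Hv x x00 _.
  by rewrite eh mevalM rmorphXn mulf_neq0 // expf_neq0.
have Sb: image_stalk x (b1 *m MK).
  by exists b1 => // r; rewrite mxE; have [_] := Hb' r; apply.
split; first by apply: free_stalkD => //; apply: image_stalk_free.
by rewrite opprD addrA; apply: image_stalkB.
Qed.

(* P / (X_0 X_1)^(D + 1) is a Cech cocycle representing the image of a section   *)
(* of the cokernel in H^1(O(- D - 2))^rho; A and B split its product by M, which *)
(* is trivial in H^1(O(- k - 2))^n.                                              *)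
Definition cech_data (P : 'I_rho -> form) (A B : 'I_n -> form) : Prop :=
  [/\ forall r, P r \is D.-homog, forall j, A j \is delta.-1.-homog,
      forall j, B j \is delta.-1.-homog
    & forall j, \sum_r P r * M r j = A j * 'X_1 ^+ D.+1 + B j * 'X_0 ^+ D.+1].

(** Each point receives one of two local lifts. For [cech_data P A B] they differ by the image under
    M of P / (X_0 X_1)^(D+1), hence define the same germ of the cokernel where X_0 X_1 <> 0. *)
Definition cech_section (A B : 'I_n -> form) q : 'rV[K]_n :=
  if q 0 0 != 0 then \row_j ((A j)%:F / ('X_0 ^+ D.+1)%:F)
  else \row_j (- ((B j)%:F / ('X_1 ^+ D.+1)%:F)).

Hypothesis delta_gt0 : (0 < delta)%N.

Lemma cech_dataE P A B : cech_data P A B ->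
  (\row_r ((P r)%:F / (('X_0 * 'X_1) ^+ D.+1)%:F)) *m MK =
  \row_j ((A j)%:F / ('X_0 ^+ D.+1)%:F) - \row_j (- ((B j)%:F / ('X_1 ^+ D.+1)%:F)).
Proof.
move=> [_ _ _ e]; apply/rowP => j; rewrite !mxE opprK.
rewrite tofrac_adddiv ?X0n_neq0 ?X1n_neq0 // -e -exprMn.
rewrite rmorph_sum mulr_suml; apply: eq_bigr => r _.
by rewrite /= tofracM /MK !mxE mulrAC.
Qed.

Lemma laurent_stalk (P : form) q : P \is D.-homog -> q 0 0 != 0 -> q 0 1 != 0 ->
  O_stalk (- D.+2%:Z) q (P%:F / (('X_0 * 'X_1) ^+ D.+1)%:F).
Proof.
move=> hP q0 q1.
apply: O_stalkM_eq (O_stalk_form _ hP) (O_stalk_inv (t := D.+1 + D.+1) _ _) _.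
- by rewrite exprMn; apply: dhomogM; apply: var_homog.
- by rewrite rmorphXn /= mevalM !mevalXU expf_neq0 // mulf_neq0.
- by clear; lia.
Qed.

Lemma cech_section_is_section P A B : cech_data P A B ->
  quotient_section free_stalk image_stalk (cech_section A B).
Proof.
move=> cd; have [hP hA hB e] := cd => p p0.
have hX (i : 'I_2) : ('X_i : form) \is 1.-homog by rewrite -['X_i]expr1 var_homog.
have E0 q : q 0 0 != 0 -> free_stalk q (\row_j ((A j)%:F / ('X_0 ^+ D.+1)%:F)).
  move=> q0 j; rewrite mxE.
  apply: O_stalkM_eq (O_stalk_form _ (hA j)) (O_stalk_inv (var_homog _ _ D.+1) _) _.
    by rewrite rmorphXn /= mevalXU expf_neq0.
  by move: delta_gt0; clear; lia.
have E1 q : q 0 1 != 0 -> free_stalk q (\row_j (- ((B j)%:F / ('X_1 ^+ D.+1)%:F))).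
  move=> q0 j; rewrite mxE; apply: O_stalkN.
  apply: O_stalkM_eq (O_stalk_form _ (hB j)) (O_stalk_inv (var_homog _ _ D.+1) _) _.
    by rewrite rmorphXn /= mevalXU expf_neq0.
  by move: delta_gt0; clear; lia.
have [p00|p00] := eqVneq (p 0 0) 0; last first.
  exists 1%N, 'X_0, (\row_j ((A j)%:F / ('X_0 ^+ D.+1)%:F)).
  split; [exact: hX | by rewrite mevalXU | move=> q q0].
  by rewrite mevalXU => q00; split; [exact: E0 | rewrite /cech_section q00 subrr;
    apply: image_stalk0].
exists 1%N, 'X_1, (\row_j (- ((B j)%:F / ('X_1 ^+ D.+1)%:F))).
split; [exact: hX | by move: p0; rewrite mevalXU row2_neq0 p00 eqxx | move=> q q0].
rewrite mevalXU => q01; split; [exact: E1 | rewrite /cech_section].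
case: ifP => q00; last by rewrite subrr; apply: image_stalk0.
rewrite -(cech_dataE cd); exists (\row_r ((P r)%:F / (('X_0 * 'X_1) ^+ D.+1)%:F)) => // r.
by rewrite mxE; apply: laurent_stalk.
Qed.

Lemma section_is_cech_section sigma : quotient_section free_stalk image_stalk sigma ->
  exists P A B, cech_data P A B /\
    forall q, q != 0 -> image_stalk q (sigma q - cech_section A B q).
Proof.
move=> sec; have [v Hv] := section_chart0 sec.
have [r [h [u [hh hoo Hu]]]] := sec (pt 0 1) (pt01_neq0 C).
have [|x x00 hx] := @form_nonroot C r h _ hh; first exact: meval_neq0 hoo.
have x0: x != 0 by rewrite row2_neq0 x00.
have [b hb eb]: image_stalk x (v - u).
  have -> : v - u = (sigma x - u) - (sigma x - v) by rewrite opprB [RHS]addrC addrA subrK.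
  by apply: image_stalkB; [have [] := Hu x x0 hx | have [] := Hv x x00].
have [P HP] := fin_all_exists (fun r => cousin_surjective (O_stalk_rat (hb r))).
have [b1 {}HP] := fin_all_exists HP.
(* The difference of lifts comes from b = P / (X_0 X_1)^(D+1) + b1 + g with b1 regular on the chart
   and g regular at (0 : 1). The part b1 is absorbed in v, and g in u. *)
pose v0 := v - (\row_r b1 r) *m MK.
pose g := b - \row_r ((P r)%:F / (('X_0 * 'X_1) ^+ D.+1)%:F) - \row_r b1 r.
pose u0 := u + g *m MK.
have e0: v0 = (\row_r ((P r)%:F / (('X_0 * 'X_1) ^+ D.+1)%:F)) *m MK + u0.
  rewrite /v0 /u0 /g !mulmxBl -eb; apply/rowP => j; rewrite !mxE; ring.
have Sb1 q : q 0 0 != 0 -> image_stalk q ((\row_r b1 r) *m MK).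
  by move=> q00; exists (\row_r b1 r) => // i; rewrite mxE; have [_ + _] := HP i; apply.
have Hv0 q : q 0 0 != 0 -> free_stalk q v0 /\ image_stalk q (sigma q - v0).
  move=> q00; have q0: q != 0 by rewrite row2_neq0 q00.
  have [Eq Sq] := Hv q q00; split.
    by apply: free_stalkD => //; apply/free_stalkN/image_stalk_free => //; apply: Sb1.
  by rewrite opprB addrCA addrC; apply: image_stalkD => //; apply: Sb1.
have Hu0 q : q != 0 -> q 0 0 = 0 -> free_stalk q u0 /\ image_stalk q (sigma q - u0).
  move=> q0 q00.
  have lq: (line (pt 0 1)).@[q 0] = 0 by rewrite meval_line pt_0 pt_1 q00 mul0r mulr0 subr0.
  have [c c0 qc] := line_root (pt01_neq0 C) q0 lq.
  have Sg: image_stalk q (g *m MK).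
    exists g => // i; rewrite !mxE qc; apply: O_stalk_scale => //.
    by have [_ _] := HP i.
  have [|Eq Sq] := Hu q q0 _; first by rewrite qc (meval_scale _ _ hh) mulf_neq0 // expf_neq0.
  split; first by apply: free_stalkD => //; apply: image_stalk_free.
  by rewrite opprD addrA; apply: image_stalkB.
(* Now v0 - u0 is P / (X_0 X_1)^(D+1) times M, with v0 regular on the chart and u0 at (0 : 1): each
   component is a coboundary of O(- k - 2), and [cousin_regular] brings it into the form of
   [cech_data]. *)
have HA j : exists A B, [/\ A \is delta.-1.-homog, B \is delta.-1.-homog,
    \sum_i P i * M i j = A * 'X_1 ^+ D.+1 + B * 'X_0 ^+ D.+1
    & v0 0 j = A%:F / ('X_0 ^+ D.+1)%:F].
  have [|N [t [A [hA eA evA]]]] := @chart0_regular C (- k.+2%:Z) (v0 0 j).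
    by move=> q q00; have [+ _] := Hv0 q q00; apply.
  have hG: \sum_i P i * M i j \is (D + delta).-homog.
    by apply: rpred_sum => i _; apply: dhomogM => //; have [] := HP i.
  have [|||A' [B [hA' hB eG eA']]] := @cousin_regular C (- k.+2%:Z) N D.+1 t (D + delta) A _ hA
    hG eA.
  - by clear; lia.
  - by move: delta_gt0; clear; lia.
  - rewrite -evA e0 mxE addrC.
    rewrite (_ : (_ *m _) 0 j = (\sum_i P i * M i j)%:F / (('X_0 * 'X_1) ^+ D.+1)%:F).
      by rewrite addrK; have [+ _] := Hu0 _ (pt01_neq0 C) (pt_0 _ _); apply.
    rewrite mxE rmorph_sum mulr_suml; apply: eq_bigr => i _.
    by rewrite /= tofracM /MK !mxE mulrAC.
  have ed: (D + delta - D.+1 = delta.-1)%N by clear; lia.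
  by exists A', B; rewrite -ed; split; rewrite // evA.
have [A {}HA] := fin_all_exists HA; have [B {}HA] := fin_all_exists HA.
have cd: cech_data P A B by split=> [i|j|j|j]; [have [] := HP i|have [] := HA j|have [] := HA
  j|have [] := HA j].
exists P, A, B; split=> // q q0.
have ev: v0 = \row_j ((A j)%:F / ('X_0 ^+ D.+1)%:F) by apply/rowP => j; rewrite [RHS]mxE;
  have [_ _ _ ->] := HA j.
rewrite /cech_section; have [q00|q00] /= := eqVneq (q 0 0) 0.
  rewrite (_ : \row_j - _ = u0); first by have [] := Hu0 q q0 q00.
  by apply: (addr_sub_eq (x := v0)); rewrite {1}e0 (cech_dataE cd) -ev.
by rewrite -ev; have [] := Hv0 q q00.
Qed.

(** This is the absence of global sections of O(- k - 2): X_0^(D+1) divides A j - A' j, whose degree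
    delta - 1 is smaller. *)
Lemma cech_data_uniq P A B A' B' : cech_data P A B -> cech_data P A' B' ->
  A =1 A' /\ B =1 B'.
Proof.
move=> [_ hA hB e] [_ hA' hB' e'].
have eA : A =1 A'.
  move=> j; apply/eqP; rewrite -subr_eq0; apply/eqP.
  have hAA: A j - A' j \is delta.-1.-homog by rewrite rpredB.
  have [||g' _ [_ o]] := @X0_pow_dvd C delta.-1 D.+1 (B' j - B j) (A j - A' j) ('X_1 ^+ D.+1) hAA.
  - by rewrite rmorphXn /= mevalXU pt_1 expr1n oner_eq0.
  - by apply/eqP; rewrite -subr_eq0; apply/eqP; move: (e j); rewrite e' => ee;
      rewrite mulrBl mulrBr ![_ * 'X_0 ^+ _]mulrC in ee *;
      rewrite -[RHS](subrr (A j * 'X_1 ^+ D.+1 + 'X_0 ^+ D.+1 * B j)) -{1}ee; ring.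
  by case/orP: o => [/eqP//|]; move: delta_gt0; clear; lia.
split=> // j; apply: (mulIf (X0n_neq0 C D.+1)).
by apply: (addrI (A j * 'X_1 ^+ D.+1)); rewrite -e {1}eA -e'.
Qed.

(** By [Minj] the preimage of the lift on the chart is the same rational vector b at all its points,
    hence regular on the chart. So P / (X_0 X_1)^(D+1) = b - c is a coboundary of O(- D - 2), and
    deg P = D < D + 1 gives P = 0. *)
Lemma cech_section_inj P A B : cech_data P A B ->
  (forall q, q != 0 -> image_stalk q (cech_section A B q)) -> P =1 fun=> 0.
Proof.
move=> cd; have [hP hA hB e] := cd => H i.
have [|b hb] := H (pt 1 0); first exact: pt10_neq0.
rewrite /cech_section pt_0 oner_neq0 => eb.
have [|c hc] := H (pt 0 1); first exact: pt01_neq0.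
rewrite /cech_section pt_0 eqxx /= => ec.
have bc: \row_r ((P r)%:F / (('X_0 * 'X_1) ^+ D.+1)%:F) = b - c.
  apply/eqP; rewrite -subr_eq0; apply/eqP; apply: Minj.
  by rewrite mulmxBl (cech_dataE cd) mulmxBl -eb -ec subrr.
have reg q : q 0 0 != 0 -> O_stalk (- D.+2%:Z) q (b 0 i).
  move=> q00; have [|b' hb'] := H q; first by rewrite row2_neq0 q00.
  rewrite /cech_section q00 eb => e'.
  suff -> : b = b' by apply: hb'.
  by apply/eqP; rewrite -subr_eq0; apply/eqP; apply: Minj; rewrite mulmxBl e' subrr.
have [N [t [Q [hQ eQ ebQ]]]] := chart0_regular reg.
apply: (@cousin_injective C (- D.+2%:Z) N D.+1 t D Q (P i) hQ (hP i) eQ).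
- by clear; lia.
- by clear; lia.
rewrite -ebQ; have /rowP/(_ i) := bc; rewrite !mxE => ->.
by rewrite opprB addrCA subrr addr0.
Qed.

(** * Syzygies as coordinates on the space of sections *)

Section CechSpace.

(* [L r l] is the coefficient of (X_0 X_1)^D in the product of [pairing_form L r] *)
(* by X_0^(D - l) X_1^l, so that [syzygy L] says that the product of L by M is   *)
(* orthogonal to all forms of degree k.                                          *)
Definition pairing_form (L : 'M[C]_(rho, D.+1)) (r : 'I_rho) : form :=
  \sum_(l < D.+1) L r l *: binary_monomial C D (D - l).

Definition syzygy (L : 'M[C]_(rho, D.+1)) : Prop := forall j a, (a <= k)%N ->
  \sum_r \sum_(b < delta.+1) L r (inord (a + b)) * (M r j)@_(mon2 delta b) = 0.

Lemma pairing_form_homog L r : pairing_form L r \is D.-homog.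
Proof.
apply: rpred_sum => l _; rewrite rpredZ // binary_monomialE dhomogX /= mdeg_mon2 //.
exact: leq_subr.
Qed.

Lemma pairing_form_inj L : (forall r, pairing_form L r = 0) -> L = 0.
Proof.
move=> H; apply/matrixP => r l; rewrite mxE.
have := congr1 (fun g : form => g@_(mon2 D (D - l))) (H r).
rewrite mcoeff0 /pairing_form raddf_sum /= (bigD1 l) //= big1 ?addr0 => [|i ne].
  by rewrite mcoeffZ binary_monomialE mcoeffX eqxx mulr1.
rewrite mcoeffZ binary_monomialE mcoeffX; case: eqP => [/mon2_inj e|]; last by rewrite mulr0.
by case/eqP: ne; apply: val_inj => /=; move: e (ltn_ord i) (ltn_ord l); clear; lia.
Qed.

Lemma pairing_form_is_linear r : linear (fun L => pairing_form L r).
Proof.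
move=> c L L'; rewrite /pairing_form scaler_sumr -big_split /=.
by apply: eq_bigr => l _; rewrite !mxE scalerDl scalerA.
Qed.

Lemma binary_monomialM d d' i j : (i <= d)%N -> (j <= d')%N ->
  binary_monomial C d i * binary_monomial C d' j = binary_monomial C (d + d') (i + j).
Proof.
move=> id jd; rewrite /binary_monomial (_ : (d + d' - (i + j) = (d - i) + (d' - j))%N).
  by rewrite !exprD; ring.
by lia.
Qed.

(** The monomial X_0^(delta+a) X_1^(D-a) is the one completed to (X_0 X_1)^D by X_0^(k-a) X_1^a. *)
Lemma syzygy_coef L j a : (a <= k)%N ->
  (\sum_r pairing_form L r * M r j)@_(mon2 (D + delta) (D - a)) =
  \sum_r \sum_(b < delta.+1) L r (inord (a + b)) * (M r j)@_(mon2 delta b).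
Proof.
move=> ak; rewrite raddf_sum /=; apply: eq_bigr => r _.
rewrite -{1}(dehomogK (hM r j)) /bform mulr_sumr raddf_sum /=; apply: eq_bigr => b _.
have bd: (b <= delta)%N by rewrite -ltnS.
rewrite coef_poly ltn_ord -scalerAr mcoeffZ mulrC; congr (_ * _).
rewrite /pairing_form mulr_suml raddf_sum /= (bigD1 (inord (a + b))) //= big1 => [|i ne].
  rewrite addr0 -scalerAl mcoeffZ binary_monomialM ?leq_subr // binary_monomialE mcoeffX
    inordK; last first.
    by move: ak bd; clear; lia.
  rewrite (_ : (D - (a + b) + b = D - a)%N) ?eqxx ?mulr1 //.
  by move: ak bd; clear; lia.
rewrite -scalerAl mcoeffZ binary_monomialM ?leq_subr // binary_monomialE mcoeffX.
case: eqP => [/mon2_inj e|]; last by rewrite mulr0.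
case/eqP: ne; apply: val_inj; rewrite /= inordK.
  by move: e ak bd (ltn_ord i); clear; lia.
by move: ak bd; clear; lia.
Qed.

(** The monomials divisible neither by X_1^(D+1) nor by X_0^(D+1) are those whose exponent of X_1
    lies between delta and D, that is, equals D - a with a <= k. *)
Lemma two_sided_form (G : form) : G \is (D + delta).-homog ->
  (forall a, (a <= k)%N -> G@_(mon2 (D + delta) (D - a)) = 0) <->
  exists A B, [/\ A \is delta.-1.-homog, B \is delta.-1.-homog
                 & G = A * 'X_1 ^+ D.+1 + B * 'X_0 ^+ D.+1].
Proof.
move=> hG; split=> [H|[A [B [hA hB ->]]] a ak].
  rewrite -(dehomogK hG) /bform.
  apply: (big_ind (fun g => exists A B, [/\ A \is delta.-1.-homog, B \is delta.-1.-homog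
                 & g = A * 'X_1 ^+ D.+1 + B * 'X_0 ^+ D.+1])).
  - by exists 0, 0; rewrite !rpred0 !mul0r addr0.
  - move=> _ _ [A [B [hA hB ->]]] [A' [B' [hA' hB' ->]]].
    by exists (A + A'), (B + B'); rewrite !rpredD //; split => //; ring.
  - move=> i _; rewrite coef_poly ltn_ord; have le: (i <= D + delta)%N by rewrite -ltnS.
    have [lb|lb] := leqP D.+1 i.
      exists (G@_(mon2 (D + delta) i) *: binary_monomial C delta.-1 (i - D.+1)), 0; split;
        rewrite ?rpred0 //.
        by rewrite rpredZ // binary_monomialE dhomogX /= mdeg_mon2; move: lb le delta_gt0;
          clear; lia.
      rewrite mul0r addr0 -scalerAl; congr (_ *: _); rewrite /binary_monomial -mulrA -exprD.
      by congr (_ ^+ _ * _ ^+ _); move: lb le delta_gt0; clear; lia.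
    have [lb'|lb'] := leqP delta i.
      exists 0, 0; rewrite !rpred0 !mul0r addr0; split=> //.
      rewrite (_ : nat_of_ord i = (D - (D - i))%N) ?H ?scale0r //; first by move: lb lb';
        clear; lia.
      by move: lb; clear; lia.
    exists 0, (G@_(mon2 (D + delta) i) *: binary_monomial C delta.-1 i); split;
      rewrite ?rpred0 //.
      by rewrite rpredZ // binary_monomialE dhomogX /= mdeg_mon2; move: lb' delta_gt0; clear; lia.
    rewrite mul0r add0r -scalerAl; congr (_ *: _); rewrite /binary_monomial mulrAC -exprD.
    by congr (_ ^+ _ * _ ^+ _); move: lb' delta_gt0; clear; lia.
rewrite mcoeffD.
have -> : (A * 'X_1 ^+ D.+1)@_(mon2 (D + delta) (D - a)) = 0.
  rewrite -(dehomogK hA) /bform mulr_suml raddf_sum big1 //= => i _; rewrite -scalerAl mcoeffZ.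
  have -> : binary_monomial C delta.-1 i * 'X_1 ^+ D.+1 = binary_monomial C (D + delta) (i +
    D.+1).
    rewrite /binary_monomial -mulrA -exprD; congr (_ ^+ _ * _ ^+ _).
    by move: (ltn_ord i) delta_gt0; clear; lia.
  rewrite binary_monomialE mcoeffX; case: eqP => [/mon2_inj e|]; last by rewrite mulr0.
  by move: e (ltn_ord i) delta_gt0 ak; clear; lia.
rewrite add0r -(dehomogK hB) /bform mulr_suml raddf_sum big1 //= => i _;
  rewrite -scalerAl mcoeffZ.
have -> : binary_monomial C delta.-1 i * 'X_0 ^+ D.+1 = binary_monomial C (D + delta) i.
  rewrite /binary_monomial mulrAC -exprD; congr (_ ^+ _ * _ ^+ _).
  by move: (ltn_ord i) delta_gt0; clear; lia.
rewrite binary_monomialE mcoeffX; case: eqP => [/mon2_inj e|]; last by rewrite mulr0.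
by move: e (ltn_ord i) delta_gt0 ak; clear; lia.
Qed.

Lemma syzygyP L : syzygy L <-> exists A B, cech_data (pairing_form L) A B.
Proof.
have hG j : \sum_r pairing_form L r * M r j \is (D + delta).-homog.
  by apply: rpred_sum => r _; apply: dhomogM; rewrite ?pairing_form_homog.
split=> [H|[A [B [_ hA hB e]]] j a ak].
  have HA j : exists A B, [/\ A \is delta.-1.-homog, B \is delta.-1.-homog
      & \sum_r pairing_form L r * M r j = A * 'X_1 ^+ D.+1 + B * 'X_0 ^+ D.+1].
    by apply/two_sided_form => // a ak; rewrite syzygy_coef ?H.
  have [A {}HA] := fin_all_exists HA; have [B {}HA] := fin_all_exists HA.
  exists A, B; split=> [r|j|j|j]; [exact: pairing_form_homog| | |]; by have [] := HA j.
rewrite -syzygy_coef //.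
by apply: (iffRL (two_sided_form (hG j))) => //; exists (A j), (B j).
Qed.

Lemma pairing_form_surj (P : 'I_rho -> form) : (forall r, P r \is D.-homog) ->
  exists L, forall r, P r = pairing_form L r.
Proof.
move=> hP; exists (\matrix_(r, l) (P r)@_(mon2 D (D - l))) => r.
rewrite -{1}(dehomogK (hP r)) /bform (reindex_inj rev_ord_inj) /=.
apply: eq_bigr => l _; rewrite mxE coef_poly subSS ifT // ltnS; exact: leq_subr.
Qed.

Theorem cech_h0 (V : {vspace 'M[C]_(rho, D.+1)}) :
  (forall L, L \in V <-> syzygy L) -> h0_quotient free_stalk image_stalk (\dim V).
Proof.
move=> HV; set N := \dim V.
have Hb (i : 'I_N) : exists A B, cech_data (pairing_form (vbasis V)`_i) A B.
  by apply/syzygyP/HV; apply/vbasis_mem/mem_nth; rewrite size_tuple.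
have [A {}Hb] := fin_all_exists Hb; have [B {}Hb] := fin_all_exists Hb.
have comb (c : 'rV[C]_N) :
    cech_data (pairing_form (\sum_i c 0 i *: (vbasis V)`_i))
      (fun j => \sum_i c 0 i *: A i j) (fun j => \sum_i c 0 i *: B i j).
  split=> [r|j|j|j].
  - exact: pairing_form_homog.
  - by apply: rpred_sum => i _; rewrite rpredZ //; have [] := Hb i.
  - by apply: rpred_sum => i _; rewrite rpredZ //; have [] := Hb i.
  - rewrite !mulr_suml -big_split /=.
    transitivity (\sum_i c 0 i *: \sum_r pairing_form (vbasis V)`_i r * M r j).
      rewrite (eq_bigr (fun r => \sum_i c 0 i *: (pairing_form (vbasis V)`_i r * M r j))).
        by rewrite exchange_big /=; apply: eq_bigr => i _; rewrite scaler_sumr.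
      move=> r _; pose f := GRing.isLinear.Build _ _ _ _ _ (pairing_form_is_linear r).
      pose F : {linear 'M[C]_(rho, D.+1) -> form} := HB.pack (fun L => pairing_form L r) f.
      rewrite (_ : pairing_form _ r = F (\sum_i c 0 i *: (vbasis V)`_i)) // linear_sum mulr_suml.
      by apply: eq_bigr => i _; rewrite linearZ /= -scalerAl.
    apply: eq_bigr => i _; have [_ _ _ /(_ j) e] := Hb i.
    by rewrite [in LHS]e scalerDr -!scalerAl.
have sum_section (c : 'rV[C]_N) q :
    \sum_(i < N) cst (c 0 i) *: cech_section (A i) (B i) q =
    cech_section (fun j => \sum_i c 0 i *: A i j) (fun j => \sum_i c 0 i *: B i j) q.
  rewrite /cech_section; case: ifP => _; apply/rowP => j;
    rewrite summxE !mxE rmorph_sum mulr_suml ?raddf_sum /=.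
    by apply: eq_bigr => i _; rewrite !mxE -mul_mpolyC tofracM mulrA.
  by apply: eq_bigr => i _; rewrite !mxE -mul_mpolyC tofracM mulrN mulrA.
exists (fun i => cech_section (A i) (B i)); split=> [i|sigma Hs].
  exact: cech_section_is_section (Hb i).
have [P [A' [B' [cd HP]]]] := section_is_cech_section Hs.
have [L eL] : exists L, P =1 pairing_form L.
  by apply: pairing_form_surj; case: cd.
have LV : L \in V.
  apply/HV/syzygyP; exists A', B'; case: cd => h1 h2 h3 h4; split=> // [r|j]; rewrite -?eL //.
  by rewrite -h4; apply: eq_bigr => r _; rewrite eL.
have bV := vbasisP V.
pose c : 'rV[C]_N := \row_i coord (vbasis V) i L.
have Hc q : q != 0 -> image_stalk q (sigma q - \sum_(i < N) cst (c 0 i) *: cech_section (A i)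
  (B i) q).
  move=> q0; rewrite sum_section.
  have cc := comb c.
  have eP : P =1 pairing_form (\sum_i c 0 i *: (vbasis V)`_i).
    move=> r; rewrite eL {1}(coord_vbasis LV); congr (pairing_form _ r).
    by apply: eq_bigr => i _; rewrite mxE.
  (* The combination of basis sections has the same P as [sigma], and P determines A and B. *)
  have cd' : cech_data P (fun j => \sum_i c 0 i *: A i j) (fun j => \sum_i c 0 i *: B i j).
    case: cc => h1 h2 h3 h4; split=> // [r|j]; rewrite ?eP //.
    by rewrite -h4; apply: eq_bigr => r _; rewrite eP.
  have [eA eB] := cech_data_uniq cd cd'.
  suff -> : cech_section (fun j => \sum_i c 0 i *: A i j) (fun j => \sum_i c 0 i *: B i j) q =
    cech_section A' B' q by apply: HP.
  by rewrite /cech_section; case: ifP => _; apply/rowP => j; rewrite !mxE -?eA -?eB.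
exists c; split=> // c' Hc'.
have H0 q : q != 0 -> image_stalk q (\sum_(i < N) cst ((c' - c) 0 i) *: cech_section (A i) (B
  i) q).
  move=> q0; have := image_stalkB (Hc q q0) (Hc' q q0).
  rewrite subr_subr => H1; rewrite (_ : \sum_(i < N) _ = \sum_(i < N) cst (c' 0 i) *:
    cech_section (A i) (B i) q - \sum_(i < N) cst (c 0 i) *: cech_section (A i) (B i) q) //.
  rewrite -sumrB; apply: eq_bigr => i _.
  by rewrite !mxE /cst mpolyCB tofracB scalerBl.
apply/rowP => i; apply/eqP; rewrite eq_sym -subr_eq0; apply/eqP.
have := cech_section_inj (comb (c' - c)) _.
rewrite -(_ : (c' - c) 0 i = c' 0 i - c 0 i); last by rewrite !mxE.
move=> /(_ _)/pairing_form_inj Hz.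
have {}Hz: \sum_i (c' - c) 0 i *: (vbasis V)`_i = 0.
  by apply: Hz => q q0; rewrite -sum_section; apply: H0.
have /freeP/(_ (fun i => (c' - c) 0 i)) := basis_free bV.
exact.
Qed.

End CechSpace.
End Cech.

(** * Restricted tangent and normal bundles *)

Section Transfer.
Variable C : numClosedFieldType.
Local Notation form := {mpoly C[2]}.
Local Notation K := {fraction form}.
Variables (V' V : lmodType K) (E' S' : 'rV[C]_2 -> V' -> Prop) (E S : 'rV[C]_2 -> V -> Prop).
Variable theta : {linear V' -> V}.

Hypothesis E'D : forall q w w', E' q w -> E' q w' -> E' q (w + w').
Hypothesis E'C : forall q c w, E' q w -> E' q (cst c *: w).
Hypothesis E'0 : forall q, q != 0 -> E' q 0.
Hypothesis S'E : forall q w, q != 0 -> S' q w -> E' q w.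
Hypothesis SB : forall q v v', q != 0 -> S q v -> S q v' -> S q (v - v').
Hypothesis theta_E : forall q w, q != 0 -> E' q w -> E q (theta w).
Hypothesis theta_S : forall q w, q != 0 -> E' q w -> S q (theta w) <-> S' q w.
Hypothesis theta_lift : forall p : 'rV[C]_2, p != 0 -> exists r h, [/\ h \is r.-homog, h.@[p 0]
  != 0
  & forall t g v, g \is t.-homog ->
      (forall q : 'rV[C]_2, q != 0 -> g.@[q 0] != 0 -> E q v) ->
      exists w, forall q : 'rV[C]_2, q != 0 -> (h * g).@[q 0] != 0 -> E' q w /\ (g.@[q 0] != 0
        -> theta w = v)].

(** [theta] is locally surjective and S' is the preimage of S in E', so E' / S' and E / S are
    isomorphic. A section being only a family of germs, its lift [tau] is chosen point by point, at
    p as a lift of a local representative around p. *)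
Lemma h0_transfer N : h0_quotient E' S' N -> h0_quotient E S N.
Proof.
move=> [beta [Hbeta Hsec]].
have E'N q w : E' q w -> E' q (- w).
  move=> h; have := E'C (-1) h; rewrite /cst mpolyCN mpolyC1 tofracN tofrac1.
  by rewrite scaleN1r.
have E'beta i q : q != 0 -> E' q (beta i q).
  move=> q0; have [r [h [v [hh hq H]]]] := Hbeta i q q0; have [Ev Sv] := H q q0 hq.
  by rewrite -(subrK v (beta i q)); apply: E'D => //; apply: S'E.
have E'sum q (c : 'rV[C]_N) : q != 0 -> E' q (\sum_i cst (c 0 i) *: beta i q).
  move=> q0; apply: (big_ind (E' q)); [exact: E'0 | by move=> *; apply: E'D|].
  by move=> i _; apply/E'C/E'beta.
exists (fun i q => theta (beta i q)); split=> [i p p0|sigma Hs].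
  have [r [h [v [hh hp H]]]] := Hbeta i p p0; exists r, h, (theta v); split=> // q q0 hq.
  have [Ev Sv] := H q q0 hq; split; first exact: theta_E.
  by rewrite -linearB; apply/theta_S => //; apply: S'E.
have [tau Htau] : exists tau, forall p : 'rV[C]_2, p != 0 -> exists r h, [/\ h \is r.-homog,
  h.@[p 0] != 0
    & forall q : 'rV[C]_2, q != 0 -> h.@[q 0] != 0 -> E' q (tau p) /\ S q (sigma q - theta (tau
      p))].
  suff /boolp.choice[tau H] : forall p : 'rV[C]_2, exists w, p != 0 -> exists r h,
      [/\ h \is r.-homog, h.@[p 0] != 0 & forall q : 'rV[C]_2, q != 0 -> h.@[q 0] != 0 ->
        E' q w /\ S q (sigma q - theta w)] by exists tau.
  move=> p.
  have [p0|p0] := eqVneq p 0; first by exists 0; rewrite ?p0 ?eqxx.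
  have [r [h [v [hh hp H]]]] := Hs p p0.
  have [r' [h' [hh' hp' H']]] := theta_lift p0.
  have [w Hw] := H' _ _ v hh (fun q q0 hq => (H q q0 hq).1).
  exists w => _; exists (r' + r)%N, (h' * h); split; first exact: dhomogM.
    by rewrite mevalM mulf_neq0.
  move=> q q0 hq; have [Ew ew] := Hw q q0 hq; split=> //.
  have hq': h.@[q 0] != 0 by apply: contraNneq hq => z; rewrite mevalM z mulr0.
  by rewrite ew //; have [] := H q q0 hq'.
have Htauq q : q != 0 -> E' q (tau q) /\ S q (sigma q - theta (tau q)).
  by move=> q0; have [r [h [hh hq H]]] := Htau q q0; apply: H.
(* Near p the single germ [tau p] represents [tau]: both lift [sigma] modulo S, so their difference
   lies in the preimage of S. *)
have tau_sec : quotient_section E' S' tau.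
  move=> p p0; have [r [h [hh hp H]]] := Htau p p0.
  exists r, h, (tau p); split=> // q q0 hq; have [Ep Sp] := H q q0 hq; split=> //.
  have [Eq Sq] := Htauq q q0; apply/theta_S => //; first by apply: E'D => //; apply: E'N.
  by rewrite linearB -(subr_subr (sigma q)); apply: SB.
have equiv (c : 'rV[C]_N) q : q != 0 ->
    S q (sigma q - \sum_(i < N) cst (c 0 i) *: theta (beta i q)) <->
    S' q (tau q - \sum_(i < N) cst (c 0 i) *: beta i q).
  move=> q0; have [Eq Sq] := Htauq q q0.
  have E1 : E' q (tau q - \sum_(i < N) cst (c 0 i) *: beta i q).
    by apply: E'D => //; apply: E'N; apply: E'sum.
  have -> : \sum_(i < N) cst (c 0 i) *: theta (beta i q) = theta (\sum_(i < N) cst (c 0 i) *: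
    beta i q).
    by rewrite linear_sum; apply: eq_bigr => i _; rewrite linearZ.
  rewrite -theta_S // linearB; split=> H1.
    by rewrite -(subr_subr (sigma q)); apply: SB.
  (* Only closure under subtraction is assumed, so x + y is obtained as x - ((y - y) - y). *)
  have := SB q0 Sq (SB q0 (SB q0 H1 H1) H1); rewrite subrr sub0r opprK addrA subrK.
  by [].
have [c [Hc uc]] := Hsec tau tau_sec.
exists c; split=> [q q0|c' Hc']; first by apply/equiv => //; apply: Hc.
by apply: uc => q q0; apply/equiv => //; apply: Hc'.
Qed.

End Transfer.

Section TangentIdentities.
Variable F : fieldType.

Lemma chart_change (fi fj fl wi wj wl : F) : fi != 0 -> fl != 0 ->
  (fl * wj - fj * wl) / fl ^+ 2 =
  ((fi * wj - fj * wi) / fi ^+ 2 * (fl / fi) - fj / fi * ((fi * wl - fl * wi) / fi ^+ 2)) / (fl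
    / fi) ^+ 2.
Proof. by move=> i0 l0; field; rewrite i0 l0. Qed.

Lemma chart_lift (fi fj fl aj al : F) : fi != 0 ->
  (fl * (fi * aj) - fj * (fi * al)) / fl ^+ 2 = (aj * (fl / fi) - fj / fi * al) / (fl / fi) ^+ 2.
Proof.
move=> i0; have [->|l0] := eqVneq fl 0; first by rewrite !mul0r !expr0n /= !invr0 !mulr0.
by field; rewrite i0 l0.
Qed.

(** The left side is the derivative of fj / fi along (b0, b1). By Euler's relations the radial
    direction contributes nothing, and only the component along t = x1 / x0 remains. *)
Lemma euler_differential (x0 x1 d fi fj pi0 pi1 pj0 pj1 b0 b1 : F) : x0 != 0 ->
  d * fi = x0 * pi0 + x1 * pi1 -> d * fj = x0 * pj0 + x1 * pj1 ->
  (fi * (b0 * pj0 + b1 * pj1) - fj * (b0 * pi0 + b1 * pi1)) / fi ^+ 2 =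
  x0 * (pj1 * fi - fj * pi1) / fi ^+ 2 * ((x0 * b1 - x1 * b0) / x0 ^+ 2).
Proof.
move=> x00 ei ej; rewrite -[RHS]mulrA [_^-1 * _]mulrC mulrA; congr (_ / _).
apply: (mulfI x00).
rewrite [LHS](_ : _ = (b0 * fi * (d * fj - x1 * pj1) - b0 * fj * (d * fi - x1 * pi1)) + b1 * x0
  * (fi * pj1 - fj * pi1)).
  by field.
by rewrite ei ej; ring.
Qed.

Lemma proportional_coord (fi fj wi wj : F) : fi != 0 -> fi * wj = fj * wi ->
  wj = wi / fi * fj.
Proof. by move=> i0 e; apply: (mulfI i0); rewrite e; field. Qed.

Lemma proportional_eq0 (fi fj b : F) : (fi * (b * fj) - fj * (b * fi)) / fi ^+ 2 = 0.
Proof. by rewrite (_ : _ - _ = 0) ?mul0r //; ring. Qed.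

Lemma euler_scale (c d x0 x1 f g0 g1 : F) : d != 0 -> d * f = x0 * g0 + x1 * g1 ->
  c * f = c / d * x0 * g0 + c / d * x1 * g1.
Proof.
move=> d0 e; rewrite -!mulrA -!mulrDr -e; congr (_ * _).
by rewrite mulrA mulVf // mul1r.
Qed.

Lemma cramer0 (b0 b1 x0 x1 y0 y1 : F) : b0 * x0 + b1 * x1 = 0 -> b0 * y0 + b1 * y1 = 0 ->
  b0 * (x0 * y1 - y0 * x1) = 0.
Proof.
move=> ex ey; rewrite (_ : _ * _ = (b0 * x0 + b1 * x1) * y1 - (b0 * y0 + b1 * y1) * x1);
  last by ring.
by rewrite ex ey !mul0r subrr.
Qed.

Lemma cramer1 (b0 b1 x0 x1 y0 y1 : F) : b0 * x0 + b1 * x1 = 0 -> b0 * y0 + b1 * y1 = 0 ->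
  b1 * (x0 * y1 - y0 * x1) = 0.
Proof.
move=> ex ey; rewrite (_ : _ * _ = (b0 * y0 + b1 * y1) * x0 - (b0 * x0 + b1 * x1) * y0);
  last by ring.
by rewrite ex ey !mul0r subrr.
Qed.

End TangentIdentities.

(** * The Euler sequence and the Jacobian matrix *)

Section Tangent.
Variable C : numClosedFieldType.
Local Notation form := {mpoly C[2]}.
Local Notation K := {fraction form}.
Local Notation "x %:F" := (FracField.tofrac x).
Implicit Types (p q : 'rV[C]_2) (m : int).

Section Euler_map.
Variables (n d : nat) (F : 'I_n.+1 -> form).
Hypothesis hF : forall j, F j \is d.-homog.

(* The surjection of the Euler sequence, computed in the affine charts; a chart  *)
(* with F i = 0 contributes a zero row because of the division by 0.            *)
Definition euler_map (w : 'rV[K]_n.+1) : 'M[K]_n.+1 :=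
  \matrix_(i, j) (((F i)%:F * w 0 j - (F j)%:F * w 0 i) / (F i)%:F ^+ 2).

Lemma euler_map_is_linear : linear euler_map.
Proof.
move=> c w w'; apply/matrixP => i j; rewrite !mxE mulrA -mulrDl.
by congr (_ / _); ring.
Qed.

HB.instance Definition _ :=
  GRing.isLinear.Build K 'rV[K]_n.+1 'M[K]_n.+1 *:%R euler_map euler_map_is_linear.

Lemma euler_map_tangent m m' q (w : 'rV[K]_n.+1) : m + d%:Z = m' ->
  (forall j, O_stalk m' q (w 0 j)) -> tangent_stalk F m q (euler_map w).
Proof.
move=> em hw; split=> [i j l i0|i j Fi]; rewrite !mxE.
  rewrite /Defs.coord; have [->|l0] := eqVneq (F l) 0.
    by rewrite tofrac0 !mul0r !expr0n /= !invr0 !mulr0.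
  by apply: chart_change; rewrite tofrac_eq0.
apply: (O_stalkM_eq (m := m' + d%:Z) (m' := - (d + d)%:Z)); last by rewrite -em; clear; lia.
  by apply: O_stalkB; apply: O_stalkM_eq (O_stalk_form _ (hF _)) (hw _) _; rewrite addrC.
rewrite -tofracXE expr2; apply: O_stalk_inv; first exact: dhomogM.
by rewrite mevalM mulf_neq0.
Qed.

(** The lift to the cone keeps the coordinate z_i fixed; the transformation law with l = i forces a
    i i = 0. *)
Lemma tangent_lift m q a i : tangent_stalk F m q a -> F i != 0 ->
  euler_map (\row_j ((F i)%:F * a i j)) = a.
Proof.
move=> [law _] i0; apply/matrixP => l j; rewrite !mxE (law i j l i0) /Defs.coord.
by rewrite chart_lift // tofrac_eq0.
Qed.

Lemma tangent_lift_stalk m m' q a i j : tangent_stalk F m q a -> (F i).@[q 0] != 0 ->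
  m + d%:Z = m' -> O_stalk m' q ((F i)%:F * a i j).
Proof.
move=> [_ reg] Fi em; apply: O_stalkM_eq (O_stalk_form _ (hF i)) (reg i j Fi) _.
by rewrite addrC.
Qed.

Lemma euler_map_eq0 q i w : (F i).@[q 0] != 0 -> euler_map w = 0 ->
  forall j, w 0 j = w 0 i / (F i)%:F * (F j)%:F.
Proof.
move=> Fi /matrixP e j; have := e i j; rewrite !mxE => /eqP.
have i0: (F i)%:F != 0 by apply: tofrac_meval_neq0 Fi.
rewrite mulf_eq0 invr_eq0 expf_eq0 /= (negPf i0) orbF subr_eq0 => /eqP e'.
exact: proportional_coord.
Qed.

End Euler_map.

Lemma free_stalk_cst n k q c (w : 'rV[K]_n) : free_stalk k q w -> free_stalk k q (cst c *: w).
Proof. by move=> h j; rewrite mxE; apply: O_stalk_cst (h j). Qed.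

Variables (n d : nat) (F : 'I_n.+1 -> form).
Hypothesis hF : forall j, F j \is d.-homog.
Hypothesis F_base : forall p, p != 0 -> exists i, (F i).@[p 0] != 0.
Variable k : nat.
Local Notation m := (- d%:Z - 2 - k%:Z).

Lemma tangent_degree : m + d%:Z = - k.+2%:Z.
Proof. by clear; lia. Qed.

Lemma tangent_theta_lift p : p != 0 -> exists r h, [/\ h \is r.-homog, h.@[p 0] != 0
  & forall t g v, g \is t.-homog ->
      (forall q, q != 0 -> g.@[q 0] != 0 -> tangent_stalk F m q v) ->
      exists w, forall q, q != 0 -> (h * g).@[q 0] != 0 -> free_stalk k q w /\ (g.@[q 0] != 0
        -> euler_map F w = v)].
Proof.
move=> p0; have [i Fi] := F_base p0; exists d, (F i); split=> // t g v hg H.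
exists (\row_j ((F i)%:F * v i j)) => q q0; rewrite mevalM mulf_eq0 negb_or => /andP[Fq gq].
split=> [j|_]; last exact: tangent_lift (H q q0 gq) (meval_neq0 Fq).
by rewrite mxE; apply: tangent_lift_stalk (H q q0 gq) Fq tangent_degree.
Qed.

Definition form_row : 'M[form]_(1, n.+1) := \row_j F j.

(** Exactness of the Euler sequence on stalks: where F_i <> 0 the factor of proportionality w_i /
    F_i is regular. *)
Lemma form_row_stalk q w : q != 0 -> free_stalk k q w ->
  euler_map F w = 0 <-> image_stalk form_row k d q w.
Proof.
move=> q0 Ew; split=> [e|[b _ ->]].
  have [i Fi] := F_base q0.
  exists (\row_r (w 0 i / (F i)%:F)) => [r|].
    by rewrite mxE; apply: O_stalkM_eq (Ew i) (O_stalk_inv (hF i) Fi) _; clear; lia.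
  apply/rowP => j; rewrite mxE big_ord1 !mxE; exact: euler_map_eq0 Fi e j.
by apply/matrixP => i j; rewrite !mxE !big_ord1 !mxE; apply: proportional_eq0.
Qed.

Lemma form_row_inj (b : 'rV[K]_1) :
  b *m map_mx (@FracField.tofrac _) form_row = 0 -> b = 0.
Proof.
move=> /rowP e; have [i Fi] := F_base (pt10_neq0 C).
apply/rowP => j; rewrite (ord1 j) mxE; apply/eqP.
have /eqP := e i; rewrite !mxE big_ord1 !mxE mulf_eq0 tofrac_eq0.
by rewrite (negPf (meval_neq0 Fi)) orbF.
Qed.

Lemma h0_restricted_tangent_transfer N :
  h0_quotient (free_stalk k) (image_stalk form_row k d) N -> h0_restricted_tangent F m N.
Proof.
apply: (@h0_transfer C 'rV[K]_n.+1 'M[K]_n.+1 (free_stalk k) (image_stalk form_row k d)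
  (tangent_stalk F m) (fun _ a => a = 0) (euler_map F)).
- exact: free_stalkD.
- by move=> q c w; exact: free_stalk_cst.
- by move=> q q0 j; rewrite mxE; apply: O_stalk0.
- by move=> q w; apply: image_stalk_free => r j; rewrite mxE.
- by move=> q v v' _ -> ->; rewrite subrr.
- by move=> q w q0; apply: euler_map_tangent tangent_degree.
- exact: form_row_stalk.
- exact: tangent_theta_lift.
Qed.

Hypothesis d_gt0 : (0 < d)%N.

Definition jacobian_form : 'M[form]_(2, n.+1) := \matrix_(r, j) (F j)^`M(r).

Lemma mderiv_homog2 (i : 'I_2) (g : form) e : g \is e.-homog -> g^`M(i) \is e.-1.-homog.
Proof.
move/dehomogK <-; rewrite /bform raddf_sum rpred_sum // => l _ /=.
have le: (l <= e)%N by rewrite -ltnS.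
rewrite mderivZ rpredZ // binary_monomialE mderivX.
have [->|ne] := eqVneq (mon2 e l i) 0%N; first by rewrite scale0r rpred0.
rewrite rpredZ // dhomogX /= -[X in _ == X.-1](mdeg_mon2 le).
have le_im : (U_(i) <= mon2 e l)%MM.
  by apply/mnm_lepP => j; rewrite mnm1E; case: eqP => // <-; rewrite lt0n.
by rewrite -[X in _ == (mdeg X).-1](submK le_im) mdegD mdeg1 addn1.
Qed.

Lemma jacobian_form_homog r j : jacobian_form r j \is d.-1.-homog.
Proof. by rewrite mxE; apply: mderiv_homog2. Qed.

Lemma euler_formula (g : form) e : g \is e.-homog ->
  e%:R *: g = 'X_0 * g^`M(0) + 'X_1 * g^`M(1).
Proof.
move/dehomogK <-; rewrite /bform scaler_sumr (linear_sum (mderiv (0 : 'I_2))) (linear_sum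
  (mderiv (1 : 'I_2))) !mulr_sumr -big_split /=.
apply: eq_bigr => l _; have le: (l <= e)%N by rewrite -ltnS.
have aux (i : 'I_2) : 'X_i * ('X_[mon2 e l])^`M(i) = (mon2 e l i)%:R *: 'X_[mon2 e l] :> form.
  rewrite mderivX -scalerAr; have [->|ne] := eqVneq (mon2 e l i) 0%N; first by rewrite !scale0r.
  congr (_ *: _); rewrite -mpolyXD addmC submK //.
  by apply/mnm_lepP => j; rewrite mnm1E; case: eqP => // <-; rewrite lt0n.
rewrite !mderivZ -!scalerAr binary_monomialE !aux mon2_0 mon2_1 -scalerDr -scalerDl.
by rewrite -natrD subnK // !scalerA mulrC.
Qed.

Lemma natr_tofrac e : e%:R = (e%:R%:MP_[2])%:F :> K.
Proof. by rewrite mpolyCMn tofracMn mpolyC1 tofrac1. Qed.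

Lemma euler_formulaF j : d%:R * (F j)%:F = ('X_0)%:F * ((F j)^`M(0))%:F + ('X_1)%:F * ((F
  j)^`M(1))%:F.
Proof.
rewrite -!tofracM -tofracD -(euler_formula (hF j)) -mul_mpolyC tofracM; congr (_ * _).
exact: natr_tofrac.
Qed.

(** The Jacobian matrix is the differential of the lift U -> C^(n+1) of f, and [euler_map] passes
    from cones to projective spaces on both sides. *)
Lemma euler_map_differential (b : 'rV[K]_2) :
  euler_map F (b *m map_mx (@FracField.tofrac _) jacobian_form) =
  differential F (euler_map (fun k : 'I_2 => 'X_k) b).
Proof.
apply/matrixP => i j; rewrite !mxE !big_ord_recl !big_ord0 !addr0 !mxE /dcoord.
rewrite (_ : lift ord0 ord0 = 1); last exact: val_inj.
rewrite (_ : ord0 = 0); last exact: val_inj.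
rewrite tofracB !tofracM.
exact: euler_differential (tofrac_neq0 (X_neq0 C 0)) (euler_formulaF i) (euler_formulaF j).
Qed.

Hypothesis jac_rank : \rank (jacobian F (pt 1 0)) = 2%N.

(** Rank 2 at one point gives a 2 x 2 minor that is nonzero as a form; Cramer's rule over the
    function field then yields injectivity. *)
Lemma jacobian_form_inj (b : 'rV[K]_2) :
  b *m map_mx (@FracField.tofrac _) jacobian_form = 0 -> b = 0.
Proof.
set A := jacobian F (pt 1 0); have rA : \rank A = 2%N := jac_rank.
have fA (v : 'rV_2) : v *m A = 0 -> v = 0.
  by move/eqP; rewrite mulmx_free_eq0 /row_free ?rA // => /eqP.
have [i [j nz]] : exists i j, A 0 i * A 1 j - A 0 j * A 1 i != 0.
  case: (boolP [exists i, exists j, A 0 i * A 1 j - A 0 j * A 1 i != 0]).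
    by move=> /existsP[i /existsP[j ne]]; exists i, j.
  (* If all minors vanish, every vector (A_1i, - A_0i) is annihilated by A, hence zero. So the row
     A_0 is zero, and A annihilates (1, 0). *)
  rewrite negb_exists => /forallP H; exfalso.
  have {}H i j : A 0 i * A 1 j = A 0 j * A 1 i.
    have := H i; rewrite negb_exists => /forallP/(_ j).
    by rewrite negbK subr_eq0 => /eqP.
  have o0 : (ord0 : 'I_2) = 0 by apply: val_inj.
  have o1 : lift (ord0 : 'I_2) ord0 = 1 by apply: val_inj.
  have A0 i : A 0 i = 0.
    have z : pt (A 1 i) (- A 0 i) *m A = 0.
      apply/rowP => j; rewrite [LHS]mxE [RHS]mxE big_ord_recl big_ord1 o1 o0 pt_0 pt_1.
      by rewrite mulNr H mulrC subrr.
    by have /rowP/(_ 1) := fA _ z; rewrite pt_1 [RHS]mxE => /eqP; rewrite oppr_eq0 => /eqP.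
  have z : pt 1 0 *m A = 0.
    apply/rowP => j; rewrite [LHS]mxE [RHS]mxE big_ord_recl big_ord1 o1 o0 pt_0 pt_1.
    by rewrite mul0r addr0 mul1r A0.
  by have /eqP := fA _ z; rewrite (negPf (pt10_neq0 C)).
move=> /rowP e.
pose g r l : K := ((F l)^`M(r))%:F.
have e' l : b 0 0 * g 0 l + b 0 1 * g 1 l = 0.
  have := e l; rewrite !mxE big_ord_recl big_ord1 !mxE.
  by rewrite (_ : lift ord0 ord0 = 1) //; apply: val_inj.
have dnz : g 0 i * g 1 j - g 0 j * g 1 i != 0.
  rewrite /g -!tofracM -tofracB tofrac_eq0; apply: contraNneq nz => z.
  by rewrite !mxE -!mevalM -mevalB z meval0.
have b0 : b 0 0 = 0.
  apply/eqP; rewrite -[_ == 0](mulIr_eq0 _ (mulIf dnz)); apply/eqP.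
  exact: cramer0 (e' i) (e' j).
have b1 : b 0 1 = 0.
  apply/eqP; rewrite -[_ == 0](mulIr_eq0 _ (mulIf dnz)); apply/eqP.
  exact: cramer1 (e' i) (e' j).
apply/rowP => -[[|[|//]] lt]; rewrite mxE.
  by rewrite -[RHS]b0; congr (b _ _); apply: val_inj.
by rewrite -[RHS]b1; congr (b _ _); apply: val_inj.
Qed.

Lemma X_homog1 (i : 'I_2) : ('X_i : form) \is 1.-homog.
Proof. by rewrite -['X_i]expr1 var_homog. Qed.

(** Let b lift to U the vector field whose differential is the image of w. Then w minus b times the
    Jacobian matrix is killed by [euler_map], hence is a multiple c F, and Euler's formula makes F
    the image of (X_0, X_1) / d. *)
Lemma jacobian_form_stalk q w : q != 0 -> free_stalk k q w ->
  differential_image F m q (euler_map F w) <-> image_stalk jacobian_form k d.-1 q w.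
Proof.
move=> q0 Ew; split=> [[a ha ea]|[b hb ->]]; last first.
  exists (euler_map (fun k : 'I_2 => 'X_k) b); last exact: euler_map_differential.
  apply: (euler_map_tangent (m' := - (k + d.-1).+2%:Z) X_homog1) => //.
  by move: d_gt0; clear; lia.
have [i qi] : exists i, q 0 i != 0.
  by move: q0; rewrite row2_neq0 => /orP[]; [exists 0 | exists 1].
have Xq : ('X_i : form).@[q 0] != 0 by rewrite mevalXU.
pose b : 'rV[K]_2 := \row_j (('X_i)%:F * a i j).
have em : m + 1%:Z = - (k + d.-1).+2%:Z by move: d_gt0; clear; lia.
have hb j : O_stalk (- (k + d.-1).+2%:Z) q (b 0 j).
  by rewrite mxE; apply: (tangent_lift_stalk X_homog1 j ha Xq em).
have eb : a = euler_map (fun k : 'I_2 => 'X_k) b by rewrite (tangent_lift ha) ?X_neq0.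
have Sb : image_stalk jacobian_form k d.-1 q (b *m map_mx (@FracField.tofrac _) jacobian_form).
  by exists b.
have EN : free_stalk k q (w - b *m map_mx (@FracField.tofrac _) jacobian_form).
  apply: free_stalkD => //; apply: free_stalkN.
  by apply: image_stalk_free Sb => //; apply: jacobian_form_homog.
have /(form_row_stalk q0 EN) [c hc ec] :
    euler_map F (w - b *m map_mx (@FracField.tofrac _) jacobian_form) = 0.
  by rewrite linearB /= euler_map_differential -eb ea subrr.
rewrite -(subrK (b *m map_mx (@FracField.tofrac _) jacobian_form) w); apply: image_stalkD => //.
have dC : d%:R != 0 :> C by rewrite Num.Theory.pnatr_eq0 -lt0n.
have dK : d%:R != 0 :> K by rewrite natr_tofrac tofrac_neq0 // mpolyC_eq0.
exists (\row_r (c 0 0 / d%:R * ('X_r)%:F)) => [r|].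
  rewrite mxE (_ : _ / _ = cst d%:R^-1 * c 0 0); last first.
    rewrite mulrC; congr (_ * _); apply: (mulfI dK); rewrite mulfV //.
    by rewrite natr_tofrac /cst -tofracM -mpolyCM mulfV ?mpolyC1 ?tofrac1.
  apply: O_stalkM_eq (O_stalk_cst _ (hc 0)) (O_stalk_form _ (X_homog1 r)) _.
  by move: d_gt0; clear; lia.
rewrite ec; apply/rowP => j; rewrite !mxE big_ord1 big_ord_recl big_ord1 !mxE.
rewrite (_ : lift ord0 ord0 = 1); last exact: val_inj.
rewrite (_ : ord0 = 0); last exact: val_inj.
exact: euler_scale dK (euler_formulaF j).
Qed.

Lemma h0_normal_transfer N :
  h0_quotient (free_stalk k) (image_stalk jacobian_form k d.-1) N -> h0_normal F m N.
Proof.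
apply: (@h0_transfer C 'rV[K]_n.+1 'M[K]_n.+1 (free_stalk k) (image_stalk jacobian_form k d.-1)
  (tangent_stalk F m) (differential_image F m) (euler_map F)).
- exact: free_stalkD.
- exact: free_stalk_cst.
- by move=> q q0 j; rewrite mxE; apply: O_stalk0.
- by move=> q w q0; apply: image_stalk_free => //; apply: jacobian_form_homog.
- move=> q v v' q0 [b hb ->] [b' hb' ->]; exists (b - b').
    (* The stalk of the tangent sheaf of P(U) is closed under subtraction because both vector fields
       lift along [euler_map] to U. *)
    have [i qi] : exists i, q 0 i != 0.
      by move: q0; rewrite row2_neq0 => /orP[]; [exists 0 | exists 1].
    have Xq : ('X_i : form).@[q 0] != 0 by rewrite mevalXU.
    have em : m + 1%:Z = - (k + d.-1).+2%:Z by move: d_gt0; clear; lia.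
    rewrite -(tangent_lift hb (X_neq0 C i)) -(tangent_lift hb' (X_neq0 C i)) -linearB.
    apply: (euler_map_tangent X_homog1 em) => j; rewrite !mxE.
    by apply: O_stalkB; [apply: (tangent_lift_stalk X_homog1 j hb Xq em) | apply:
      (tangent_lift_stalk X_homog1 j hb' Xq em)].
  by apply/matrixP => i j; rewrite !mxE mulrBr.
- by move=> q w q0; apply: euler_map_tangent tangent_degree.
- exact: jacobian_form_stalk.
- exact: tangent_theta_lift.
Qed.

End Tangent.

(** * The operator D in coordinates *)

Section ScaledCoefficients.
Variable C : numClosedFieldType.
Implicit Types (u : {mpoly C[4]}) (x y z v : nat).

Definition mon4 x y z v : 'X_{1..4} := [multinom nth 0%N [:: x; y; z; v] i | i < 4].

Lemma mon4E x y z v (i : 'I_4) : mon4 x y z v i = nth 0%N [:: x; y; z; v] i.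
Proof. by rewrite mnmE. Qed.

Lemma mon4_sum x y z v :
  mon4 x y z v = (U_(0%R) *+ x + U_(1%R) *+ y + U_(2%:R) *+ z + U_(3%:R) *+ v)%MM.
Proof.
apply/mnmP => i; rewrite mon4E.
by case: i => -[|[|[|[|//]]]] lt; rewrite !mnmDE !mulmnE !mnm1E !eqE /=; lia.
Qed.

Lemma mon4P (m : 'X_{1..4}) : m = mon4 (m 0%R) (m 1%R) (m 2%:R) (m 3%:R).
Proof.
by apply/mnmP => i; rewrite mon4E; case: i => -[|[|[|[|//]]]] lt; congr (m _); apply: val_inj.
Qed.

Lemma mdeg_mon4 x y z v : mdeg (mon4 x y z v) = (x + y + z + v)%N.
Proof. by rewrite mon4_sum !mdegD !mdegMn !mdeg1 !mul1n. Qed.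

Lemma mon4_inj x y z v x' y' z' v' : mon4 x y z v = mon4 x' y' z' v' ->
  [/\ x = x', y = y', z = z' & v = v'].
Proof.
move=> e; split.
- by have := congr1 (fun m : 'X_{1..4} => m 0%R) e; rewrite /= !mon4E.
- by have := congr1 (fun m : 'X_{1..4} => m 1%R) e; rewrite /= !mon4E.
- by have := congr1 (fun m : 'X_{1..4} => m 2%:R) e; rewrite /= !mon4E.
- by have := congr1 (fun m : 'X_{1..4} => m 3%:R) e; rewrite /= !mon4E.
Qed.

(* Divided-power coordinates, in which [D_poly] has constant coefficients. *)
Definition scoef u x y z v : C :=
  u@_(mon4 x y z v) * (x`! * y`! * (z`! * v`!))%:R.

Lemma scoef_D u x y z v :
  scoef (D_poly u) x y z v = scoef u x.+1 y z v.+1 - scoef u x y.+1 z.+1 v.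
Proof.
rewrite /scoef /D_poly mcoeffB !mcoeff_mderiv.
have -> : (mon4 x y z v + U_(0%R) + U_(3%:R))%MM = mon4 x.+1 y z v.+1.
  by apply/mnmP => -[[|[|[|[|//]]]] lt]; rewrite !mnmDE !mon4E !mnm1E !eqE /=; lia.
have -> : (mon4 x y z v + U_(1%R) + U_(2%:R))%MM = mon4 x y.+1 z.+1 v.
  by apply/mnmP => -[[|[|[|[|//]]]] lt]; rewrite !mnmDE !mon4E !mnm1E !eqE /=; lia.
rewrite [(_ + _)%MM 3%:R]mnmDE [(_ + _)%MM 2%:R]mnmDE !mon4E !mnm1E !eqE /= !addn0.
rewrite -(mulr_natr _ x.+1) -(mulr_natr _ y.+1) -(mulr_natr _ z.+1) -(mulr_natr _ v.+1) !factS
  !natrM.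
move: (u@__) (u@__) (x.+1%:R : C) (y.+1%:R : C) (z.+1%:R : C) (v.+1%:R : C).
by move: (x`!%:R : C) (y`!%:R : C) (z`!%:R : C) (v`!%:R : C) => *; ring.
Qed.

Lemma scoef_eq0 u : (forall x y z v, scoef u x y z v = 0) -> u = 0.
Proof.
move=> H; apply/mpolyP => m; rewrite mcoeff0 (mon4P m); apply/eqP.
have /eqP := H (m 0%R) (m 1%R) (m 2%:R) (m 3%:R); rewrite mulf_eq0 => /orP[//|].
by rewrite Num.Theory.pnatr_eq0 !muln_eq0 !gtn_eqF ?fact_gt0.
Qed.

Lemma scoef0 x y z v : scoef 0 x y z v = 0.
Proof. by rewrite /scoef mcoeff0 mul0r. Qed.

Variables k d : nat.

Definition bidegree_poly (c : 'M[C]_(k.+1, d.+1)) : {mpoly C[4]} :=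
  \sum_(a < k.+1) \sum_(b < d.+1) c a b *: 'X_[mon4 (k - a) a (d - b) b].

Lemma bidegree_poly_homog c : bidegree_poly c \is (k + d).-homog.
Proof.
apply: rpred_sum => a _; apply: rpred_sum => b _; rewrite rpredZ // dhomogX /= mdeg_mon4.
by apply/eqP; move: (ltn_ord a) (ltn_ord b); clear; lia.
Qed.

Definition bifact (a b : nat) : C := ((k - a)`! * a`! * ((d - b)`! * b`!))%:R.

Lemma bifact_neq0 a b : bifact a b != 0.
Proof. by rewrite Num.Theory.pnatr_eq0 !muln_eq0 !gtn_eqF ?fact_gt0. Qed.

(** The tensor whose divided-power coordinates [scoef] form the array t. *)
Definition array_fun (t : 'M[C]_(k.+1, d.+1)) : dhomog 4 C (k + d) :=
  DHomog (bidegree_poly_homog (\matrix_(a, b) (t a b / bifact a b))).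

Lemma array_fun_is_linear : linear array_fun.
Proof.
move=> c t t'; apply: val_inj => /=; rewrite /bidegree_poly scaler_sumr -big_split.
apply: eq_bigr => a _; rewrite scaler_sumr -big_split; apply: eq_bigr => b _ /=.
by rewrite !mxE scalerA -scalerDl; congr (_ *: _); rewrite mulrDl mulrA.
Qed.

HB.instance Definition _ := GRing.isLinear.Build C 'M[C]_(k.+1, d.+1)
  (dhomog 4 C (k + d)) *:%R array_fun array_fun_is_linear.

Lemma bidegree_poly_coef c x y z v :
  (bidegree_poly c)@_(mon4 x y z v) =
  if ((x + y)%N == k) && ((z + v)%N == d) then c (inord y) (inord v) else 0.
Proof.
rewrite /bidegree_poly raddf_sum /=; under eq_bigr do rewrite raddf_sum /=.
case: ifP => [/andP[/eqP ek /eqP ed]|ne].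
  have yk : (y < k.+1)%N by rewrite ltnS -ek leq_addl.
  have vd : (v < d.+1)%N by rewrite ltnS -ed leq_addl.
  have ex : (k - y)%N = x by rewrite -ek addnK.
  have ez : (d - v)%N = z by rewrite -ed addnK.
  rewrite (bigD1 (inord y)) //= (bigD1 (inord v)) //= !big1 ?addr0.
  - by rewrite mcoeffZ mcoeffX (inordK yk) (inordK vd) ex ez eqxx mulr1.
  - move=> a na; apply: big1 => b _; rewrite mcoeffZ mcoeffX;
      case: eqP => [/mon4_inj[_ e _ _]|]; last by rewrite mulr0.
    by case/eqP: na; apply: val_inj; rewrite /= inordK.
  - move=> b nb; rewrite mcoeffZ mcoeffX; case: eqP => [/mon4_inj[_ _ _ e]|];
      last by rewrite mulr0.
    by case/eqP: nb; apply: val_inj; rewrite /= inordK.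
rewrite big1 // => a _; apply: big1 => b _; rewrite mcoeffZ mcoeffX;
  case: eqP => [/mon4_inj[e1 e2 e3 e4]|]; last by rewrite mulr0.
by move: ne (ltn_ord a) (ltn_ord b); rewrite -e1 -e2 -e3 -e4 !subnK ?eqxx // -ltnS.
Qed.

Lemma scoef_array t x y z v :
  scoef (array_fun t) x y z v =
  if ((x + y)%N == k) && ((z + v)%N == d) then t (inord y) (inord v) else 0.
Proof.
rewrite /scoef bidegree_poly_coef; case: ifP => [/andP[/eqP ek /eqP ed]|]; last by rewrite mul0r.
have yk : (y < k.+1)%N by rewrite ltnS -ek leq_addl.
have vd : (v < d.+1)%N by rewrite ltnS -ed leq_addl.
have ex : (k - y)%N = x by rewrite -ek addnK.
have ez : (d - v)%N = z by rewrite -ed addnK.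
rewrite mxE /bifact (inordK yk) (inordK vd) ex ez mulfVK //.
by rewrite Num.Theory.pnatr_eq0 !muln_eq0 !gtn_eqF ?fact_gt0.
Qed.

Lemma scoef_array_ord t a b : (a <= k)%N -> (b <= d)%N ->
  scoef (array_fun t) (k - a) a (d - b) b = t (inord a) (inord b).
Proof. by move=> ak bd; rewrite scoef_array !subnK ?eqxx. Qed.

Lemma array_fun_eq0 t : array_fun t = 0 -> t = 0.
Proof.
move=> e; apply/matrixP => a b; rewrite mxE.
have := scoef_array_ord t (leq_ord a) (leq_ord b); rewrite e !inord_val => <-.
exact: scoef0.
Qed.

Lemma array_D_eq0 t : (array_fun t \in lker (D (k + d))) <->
  forall a b, (a < k)%N -> (b < d)%N -> t (inord a) (inord b.+1) = t (inord a.+1) (inord b).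
Proof.
rewrite memv_ker lfunE /=; split=> [/eqP/(congr1 val) /= e a b ak bd|H].
  have := scoef_D (array_fun t) (k - a.+1) a (d - b.+1) b; rewrite [D_poly _]e scoef0.
  have e1 : ((k - a.+1).+1 + a == k)%N by apply/eqP; move: ak; clear; lia.
  have e2 : ((d - b.+1) + b.+1 == d)%N by apply/eqP; move: bd; clear; lia.
  have e3 : ((k - a.+1) + a.+1 == k)%N by apply/eqP; move: ak; clear; lia.
  have e4 : ((d - b.+1).+1 + b == d)%N by apply/eqP; move: bd; clear; lia.
  by rewrite !scoef_array e1 e2 e3 e4 /= => /esym/eqP; rewrite subr_eq0 => /eqP.
apply/eqP/val_inj/scoef_eq0 => x y z v; rewrite [val _]/(D_poly (array_fun t)) scoef_D
  !scoef_array.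
rewrite !addSn !addnS; case: ifP => [/andP[/eqP ek /eqP ed]|]; last by rewrite subrr.
by rewrite H ?subrr //; move: ek ed; clear; lia.
Qed.

(** Vanishing second differences along antidiagonals. For k = 1 the condition is empty, in
    accordance with D^2 = 0 on bidegree (1, d). *)
Lemma array_D2_eq0 t : (array_fun t \in lker (D2 (k + d))) <->
  forall a b, (a.+1 < k)%N -> (b.+1 < d)%N ->
  t (inord a) (inord b.+2) - t (inord a.+1) (inord b.+1) =
  t (inord a.+1) (inord b.+1) - t (inord a.+2) (inord b).
Proof.
rewrite memv_ker comp_lfunE !lfunE /=; split=> [/eqP/(congr1 val) /= e a b ak bd|H].
  have := scoef_D (D_poly (array_fun t)) (k - a.+2) a (d - b.+2) b.
  rewrite [X in scoef X _ _ _ _]e scoef0 !scoef_D !scoef_array.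
  have e1 : ((k - a.+2).+2 + a == k)%N by apply/eqP; move: ak; clear; lia.
  have e2 : ((d - b.+2) + b.+2 == d)%N by apply/eqP; move: bd; clear; lia.
  have e3 : ((k - a.+2).+1 + a.+1 == k)%N by apply/eqP; move: ak; clear; lia.
  have e4 : ((d - b.+2).+1 + b.+1 == d)%N by apply/eqP; move: bd; clear; lia.
  have e5 : ((k - a.+2) + a.+2 == k)%N by apply/eqP; move: ak; clear; lia.
  have e6 : ((d - b.+2).+2 + b == d)%N by apply/eqP; move: bd; clear; lia.
  by rewrite e1 e2 e3 e4 e5 e6 /= => /esym/eqP; rewrite subr_eq0 => /eqP.
apply/eqP/val_inj/scoef_eq0 => x y z v.
rewrite [val _]/(D_poly (D_poly (array_fun t))) !scoef_D !scoef_array.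
rewrite !addSn !addnS; case: ifP => [/andP[/eqP ek /eqP ed]|]; last by rewrite !subrr.
by rewrite H ?subrr //; move: ek ed; clear; lia.
Qed.

Lemma comp_binary_monomial (f g : {mpoly C[4]}) r i :
  binary_monomial C r i \mPo [tuple f; g] = f ^+ (r - i) * g ^+ i.
Proof.
rewrite binary_monomialE comp_mpolyX big_ord_recl big_ord1.
rewrite (_ : lift ord0 ord0 = 1); last exact: val_inj.
rewrite (_ : ord0 = 0); last exact: val_inj.
by rewrite mon2_0 mon2_1.
Qed.

Lemma bidegree_polyM (u w : {mpoly C[2]}) : u \is k.-homog -> w \is d.-homog ->
  left_factor u * right_factor w =
  bidegree_poly (\matrix_(a, b) (u@_(mon2 k a) * w@_(mon2 d b))) :> {mpoly C[4]}.
Proof.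
move=> /dehomogK eu /dehomogK ew; rewrite -[in LHS]eu -[in LHS]ew.
rewrite /left_factor /right_factor /bform !raddf_sum mulr_suml; apply: eq_bigr => a _.
rewrite mulr_sumr; apply: eq_bigr => b _ /=.
rewrite !coef_poly !ltn_ord !comp_mpolyZ -scalerAl -scalerAr scalerA mxE; congr (_ *: _).
by rewrite !comp_binary_monomial mon4_sum !mpolyXD -!mpolyXn !mulrA.
Qed.

Lemma tens_bidegree (u : dhomog 2 C k) (w : dhomog 2 C d) :
  tens u w = bidegree_poly (\matrix_(a, b) ((val u)@_(mon2 k a) * (val w)@_(mon2 d b))) :>
    {mpoly C[4]}.
Proof. exact: (bidegree_polyM (dhomog_is_dhomog u) (dhomog_is_dhomog w)). Qed.

Variables (s : nat) (pi : 'Hom(dhomog 2 C d, 'rV[C]_s.+1)).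

Lemma coef_binary_monomial r i j : (binary_monomial C r i)@_(mon2 r j) = (i == j)%:R.
Proof.
by rewrite binary_monomialE mcoeffX; congr ((nat_of_bool _)%:R); apply/eqP/eqP => [/mon2_inj|->].
Qed.

Lemma curve_forms_coef j (b : 'I_d.+1) :
  (curve_forms pi j)@_(mon2 d b) = 'C(d, b)%:R * pi (DHomog (binary_monomial_homog C b)) 0 j.
Proof.
rewrite /curve_forms raddf_sum /= (bigD1 b) //= big1 ?addr0 => [|i ne].
  by rewrite mcoeffZ coef_binary_monomial eqxx mulr1.
by rewrite mcoeffZ coef_binary_monomial -[_ == _ :> nat]/(i == b) (negPf ne) mulr0.
Qed.

Definition slice (c : 'M[C]_(k.+1, d.+1)) (a : 'I_k.+1) : dhomog 2 C d :=
  \sum_(b < d.+1) c a b *: DHomog (binary_monomial_homog C b).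

Lemma tens_Sym (u : dhomog 2 C k) (w : dhomog 2 C d) (T : {vspace dhomog 2 C d}) :
  w \in T -> tens u w \in Sym_tens k T.
Proof.
move=> wT.
have -> : tens u w = \sum_i \sum_j (coord (vbasis fullv) i u * coord (vbasis T) j w)
    *: tens (vbasis fullv)`_i (vbasis T)`_j.
  apply: val_inj => /=; rewrite [in LHS](coord_vbasis (memvf u)) [in LHS](coord_vbasis wT).
  rewrite /left_factor /right_factor !raddf_sum mulr_suml; apply: eq_bigr => i _.
  rewrite raddf_sum mulr_sumr; apply: eq_bigr => j _ /=.
  by rewrite !comp_mpolyZ -scalerAl -scalerAr scalerA.
apply: rpred_sum => i _; apply: rpred_sum => j _; rewrite rpredZ // memv_span //.
by apply/allpairsP; exists ((vbasis fullv)`_i, (vbasis T)`_j); rewrite !mem_nth ?size_tuple.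
Qed.

(** The monomials of degree k are a basis of the left factor, so membership in S^k U (x) T can be
    tested on their coefficients in S^d U. *)
Lemma Sym_tensP (T : {vspace dhomog 2 C d}) w : w \in Sym_tens k T <->
  exists2 c, val w = bidegree_poly c & forall a, slice c a \in T.
Proof.
split=> [wS|[c ec cT]].
  rewrite (@coord_span _ _ _ (in_tuple _) w wS).
  apply: (big_ind (fun w : dhomog 4 C (k + d) => exists2 c, val w = bidegree_poly c & forall a,
    slice c a \in T)).
  - exists 0 => [|a]; last by rewrite /slice big1 ?rpred0 // => b _; rewrite mxE scale0r.
    by rewrite /bidegree_poly big1 // => a _; rewrite big1 // => b _; rewrite mxE scale0r.
  - move=> w1 w2 [c1 e1 H1] [c2 e2 H2]; exists (c1 + c2) => [|a].
      rewrite /= [val w1]e1 [val w2]e2 /bidegree_poly -big_split; apply: eq_bigr => a _.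
      by rewrite -big_split; apply: eq_bigr => b _; rewrite mxE scalerDl.
    suff -> : slice (c1 + c2) a = slice c1 a + slice c2 a by rewrite rpredD.
    by rewrite /slice -big_split; apply: eq_bigr => b _; rewrite mxE scalerDl.
  - move=> i _; set x := coord _ _ _.
    have /allpairsP[[u v] /= [_ hv ->]] := mem_nth 0 (ltn_ord i).
    exists (x *: \matrix_(a, b) ((val u)@_(mon2 k a) * (val v)@_(mon2 d b))) => [|a].
      rewrite /= [X in _ *: X](tens_bidegree u v) /bidegree_poly scaler_sumr;
        apply: eq_bigr => a _.
      by rewrite scaler_sumr; apply: eq_bigr => b _; rewrite !mxE scalerA.
    suff -> : slice (x *: \matrix_(a, b) ((val u)@_(mon2 k a) * (val v)@_(mon2 d b))) a = (x *
      (val u)@_(mon2 k a)) *: v.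
      by rewrite rpredZ // vbasis_mem.
    apply: val_inj; rewrite /= -[in RHS](dehomogK (dhomog_is_dhomog v)) raddf_sum scaler_sumr.
    by apply: eq_bigr => b _; rewrite /= !mxE coef_poly ltn_ord scalerA mulrA.
have -> : w = \sum_a tens (DHomog (binary_monomial_homog C a)) (slice c a).
  apply: val_inj; rewrite [LHS]ec raddf_sum; apply: eq_bigr => a _.
  apply: etrans (esym (tens_bidegree _ _)).
  rewrite /bidegree_poly [RHS](bigD1 a) //= [X in _ = _ + X]big1 ?addr0 => [|a' ne].
    apply: eq_bigr => b _; rewrite mxE /= binary_monomialE mcoeffX eqxx mul1r.
    congr (_ *: _); rewrite raddf_sum raddf_sum /= (bigD1 b) //= big1 ?addr0 => [|b' ne].
      by rewrite mcoeffZ binary_monomialE mcoeffX eqxx mulr1.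
    rewrite mcoeffZ binary_monomialE mcoeffX; case: eqP => [/mon2_inj/val_inj e|];
      last by rewrite mulr0.
    by rewrite e eqxx in ne.
  apply: big1 => b _; rewrite mxE /= binary_monomialE mcoeffX.
  case: eqP => [/mon2_inj/val_inj e|]; last by rewrite mul0r scale0r.
  by rewrite e eqxx in ne.
by apply: rpred_sum => a _; apply: tens_Sym.
Qed.

Lemma Sym_tens_array w : w \in Sym_tens k (lker pi) -> exists t, w = array_fun t.
Proof.
move/Sym_tensP => [c ec _]; exists (\matrix_(a, b) (c a b * bifact a b)).
apply: val_inj; rewrite /= ec; congr bidegree_poly; apply/matrixP => a b.
by rewrite !mxE mulfK // bifact_neq0.
Qed.

Lemma bidegree_poly_inj : injective bidegree_poly.
Proof.
move=> c c' e; apply/matrixP => a b.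
have := congr1 (fun u : {mpoly C[4]} => u@_(mon4 (k - a) a (d - b) b)) e.
by rewrite /= !bidegree_poly_coef !subnK ?leq_ord // !eqxx /= !inord_val.
Qed.

(** The factorials of the divided-power coordinates absorb the binomial coefficients of
    [curve_forms], since C(d, b) = d! / ((d - b)! b!). Thus each row of t, paired with the
    coefficients of F_j, gives a nonzero multiple of a component of [pi] on the slice. *)
Lemma array_Sym t : array_fun t \in Sym_tens k (lker pi) <->
  forall j a, (a <= k)%N ->
    \sum_(b < d.+1) t (inord a) b * (curve_forms pi j)@_(mon2 d b) = 0.
Proof.
set c := \matrix_(a, b) (t a b / bifact a b).
have key (a : 'I_k.+1) j : \sum_(b < d.+1) t a b * (curve_forms pi j)@_(mon2 d b) =
    ((k - a)`! * a`! * d`!)%:R * pi (slice c a) 0 j.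
  rewrite /slice linear_sum summxE mulr_sumr; apply: eq_bigr => b _.
  rewrite linearZ_LR !mxE curve_forms_coef.
  have bd : (b <= d)%N by rewrite leq_ord.
  rewrite /bifact -(bin_fact bd) !natrM; set p := pi _ 0 j.
  field; by rewrite -?natrM ?Num.Theory.pnatr_eq0 ?gtn_eqF ?fact_gt0.
split=> [/Sym_tensP[c' /bidegree_poly_inj <- H] j a ak|H].
  have := key (inord a) j; have := H (inord a); rewrite memv_ker => /eqP ->.
  by rewrite mxE mulr0.
apply/Sym_tensP; exists c => // a; rewrite memv_ker; apply/eqP/rowP => j.
have := H j a (leq_ord a); rewrite inord_val key mxE => /eqP.
by rewrite mulf_eq0 Num.Theory.pnatr_eq0 !muln_eq0 !gtn_eqF ?fact_gt0 //= => /eqP.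
Qed.

End ScaledCoefficients.

(** * The kernels of D and D^2 as spaces of syzygies *)

Section TangentArrays.
Variable C : numClosedFieldType.
Variables (k d s : nat) (pi : 'Hom(dhomog 2 C d, 'rV[C]_s.+1)).
Local Notation F := (curve_forms pi).

Section ArrayDim.
Variables (rho m : nat) (tau : 'M[C]_(rho, m) -> 'M[C]_(k.+1, d.+1)).
Hypothesis tau_lin : linear tau.
Hypothesis tau_inj : forall L, tau L = 0 -> L = 0.
Variable U : {vspace dhomog 4 C (k + d)}.
Hypothesis tau_im : forall t, array_fun t \in U <-> exists L, t = tau L.

(** The common part of both cases: [tau] parametrizes the kernel U by functionals, and V is the
    preimage of the intersection under this parametrization. *)
Lemma array_dim : exists2 V : {vspace 'M[C]_(rho, m)},
  \dim V = \dim (U :&: Sym_tens k (lker pi))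
  & forall L, L \in V <-> forall j a, (a <= k)%N ->
      \sum_(b < d.+1) tau L (inord a) b * (F j)@_(mon2 d b) = 0.
Proof.
pose Psi L := array_fun (tau L).
have Psi_lin : linear Psi by move=> c L L'; rewrite /Psi tau_lin linearP.
pose f := GRing.isLinear.Build _ _ _ _ _ Psi_lin.
pose P : {linear 'M[C]_(rho, m) -> dhomog 4 C (k + d)} := HB.pack Psi f.
have PE L : linfun P L = array_fun (tau L) by rewrite lfunE.
set W := (U :&: Sym_tens k (lker pi))%VS.
have sub : (W <= limg (linfun P))%VS.
  apply/subvP => w; rewrite memv_cap => /andP[wU /Sym_tens_array[t et]].
  move: wU; rewrite et => /tau_im[L ->]; rewrite -PE; exact: memv_img (memvf _).
have ker0 : lker (linfun P) = 0%VS.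
  apply/eqP; rewrite -subv0; apply/subvP => L; rewrite memv_ker PE memv0 => /eqP e.
  by apply/eqP/tau_inj/array_fun_eq0.
exists (linfun P @^-1: W)%VS.
  rewrite -{2}(lpreimK sub) limg_dim_eq //; first by rewrite ker0 capv0.
move=> L; rewrite -memv_preim PE memv_cap; split=> [/andP[_ /array_Sym]//|H].
by apply/andP; split; [apply/tau_im; exists L | apply/array_Sym].
Qed.

End ArrayDim.

(* The polarization of a form of degree k + d has coefficients t_(a, b) = l_(a + b). *)
Lemma tangent_array_dim : exists2 V : {vspace 'M[C]_(1, (k + d).+1)},
  \dim V = \dim (lker (D (k + d)) :&: Sym_tens k (lker pi))
  & forall L, L \in V <-> @syzygy C 1 s.+1 (form_row F) k d L.
Proof.
pose tau (L : 'M[C]_(1, (k + d).+1)) : 'M[C]_(k.+1, d.+1) := \matrix_(a, b) L 0 (inord (a + b)).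
have tauE L a b : (a <= k)%N -> (b <= d)%N -> tau L (inord a) (inord b) = L 0 (inord (a + b)).
  by move=> ak bd; rewrite mxE !inordK.
have [| | |V dV HV] := @array_dim _ _ tau _ _ (lker (D (k + d))).
- by move=> c L L'; apply/matrixP => a b; rewrite !mxE.
- move=> L e; apply/matrixP => i c; rewrite (ord1 i) mxE.
  have := tauE L (c - minn c d)%N (minn c d).
  have cD := ltn_ord c; rewrite e mxE subnK ?geq_minl // inord_val => <- //; last exact: geq_minr.
  by move: cD; clear; lia.
- move=> t; rewrite array_D_eq0; split=> [H|[L ->] a b ak bd]; last first.
    by rewrite !tauE ?addSnnS // ltnW.
  have Hn n a b : (n <= a)%N -> (a <= k)%N -> (b + n <= d)%N ->
      t (inord a) (inord b) = t (inord (a - n)) (inord (b + n)).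
    elim: n => [|n IH] na ak bd; first by rewrite subn0 addn0.
    rewrite IH; try (by move: na ak bd; clear; lia).
    rewrite (_ : (a - n = (a - n.+1).+1)%N); last by move: na; clear; lia.
    by rewrite -H ?addnS //; move: na ak bd; clear; lia.
  (* The antidiagonal c is represented by its entry with the largest column, b = min(c, d). *)
  exists (\row_c t (inord (c - minn c d)) (inord (minn c d))).
  apply/matrixP => a b; rewrite !mxE inordK; last first.
    by move: (ltn_ord a) (ltn_ord b); clear; lia.
  have ak := leq_ord a; have bd := leq_ord b.
  rewrite -{1}(inord_val a) -{1}(inord_val b).
  rewrite (Hn (minn (a + b) d - b)%N) //; try by (move: ak bd; clear; lia).
  by congr (t (inord _) (inord _)); move: ak bd; clear; lia.
exists V => // L; rewrite HV; split=> H j a ak.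
  rewrite big_ord1 -[RHS](H j a ak); apply: eq_bigr => b _.
  by rewrite !mxE inordK.
have e := H j a ak; rewrite big_ord1 in e; rewrite -[RHS]e; apply: eq_bigr => b _.
by rewrite !mxE inordK.
Qed.

Hypotheses (k_gt0 : (0 < k)%N) (d_gt0 : (0 < d)%N).

Lemma sum_ord2 (V : zmodType) (f : 'I_2 -> V) : \sum_r f r = f 0 + f 1.
Proof. by rewrite big_ord_recl big_ord1; congr (f _ + f _); apply: val_inj. Qed.

Lemma mon2_addU0 r i : (i <= r)%N -> (mon2 r i + U_(0%R))%MM = mon2 r.+1 i.
Proof.
move=> le; apply/mnmP => -[[|[|//]] lt].
  rewrite (_ : Ordinal lt = 0); last exact: val_inj.
  by rewrite mnmDE !mon2_0 mnm1E eqxx; move: le; clear; lia.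
rewrite (_ : Ordinal lt = 1); last exact: val_inj.
by rewrite mnmDE !mon2_1 mnm1E /= addn0.
Qed.

Lemma mon2_addU1 r i : (mon2 r i + U_(1%R))%MM = mon2 r.+1 i.+1.
Proof.
apply/mnmP => -[[|[|//]] lt].
  rewrite (_ : Ordinal lt = 0); last exact: val_inj.
  by rewrite mnmDE !mon2_0 mnm1E /= addn0 subSS.
rewrite (_ : Ordinal lt = 1); last exact: val_inj.
by rewrite mnmDE !mon2_1 mnm1E eqxx addn1.
Qed.

Lemma affine_of_second_difference (g : nat -> C) (lo hi : nat) :
  (forall n, (lo <= n)%N -> (n.+2 <= hi)%N -> g n.+2 - g n.+1 = g n.+1 - g n) ->
  forall n, (lo + n <= hi)%N -> g (lo + n)%N = g lo + n%:R * (g lo.+1 - g lo).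
Proof.
move=> H; suff step n : (lo + n.+1 <= hi)%N ->
    g (lo + n)%N = g lo + n%:R * (g lo.+1 - g lo) /\
    g (lo + n.+1)%N = g lo + n.+1%:R * (g lo.+1 - g lo).
  by case=> [_|n /step[]//]; rewrite addn0 mul0r addr0.
elim: n => [|n IH] le.
  by rewrite addn0 addn1 mul0r addr0 mul1r addrC subrK.
have [|e1 e2] := IH; first by move: le; clear; lia.
split=> //; have := H (lo + n)%N; rewrite -!addnS => /(_ _ _)/eqP.
rewrite subr_eq e1 e2 => /(_ _ _)/eqP -> ; rewrite ?leq_addr //.
by rewrite -!natr1; ring.
Qed.

(* The kernel of D2 consists of the arrays that are affine along antidiagonals,  *)
(* i.e. of t_(a, b) = (d - b) l0_(a + b) + b l1_(a + b - 1).                      *)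
Lemma normal_array_dim : exists2 V : {vspace 'M[C]_(2, (k + d.-1).+1)},
  \dim V = \dim (lker (D2 (k + d)) :&: Sym_tens k (lker pi))
  & forall L, L \in V <-> @syzygy C 2 s.+1 (jacobian_form F) k d.-1 L.
Proof.
(* The two bad indices carry the factor 0: d - b for [L 0] at a + b = k + d, and b for [L 1] at a +
   b = 0. *)
pose tau (L : 'M[C]_(2, (k + d.-1).+1)) : 'M[C]_(k.+1, d.+1) :=
  \matrix_(a, b) ((d - b)%:R * L 0 (inord (a + b)) + b%:R * L 1 (inord (a + b).-1)).
have tauE L a b : (a <= k)%N -> (b <= d)%N -> tau L (inord a) (inord b) =
    (d - b)%:R * L 0 (inord (a + b)) + b%:R * L 1 (inord (a + b).-1).
  by move=> ak bd; rewrite mxE !inordK.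
have dn0 : d%:R != 0 :> C by rewrite Num.Theory.pnatr_eq0 -lt0n.
have [| | |V dV HV] := @array_dim _ _ tau _ _ (lker (D2 (k + d))).
- by move=> c L L'; apply/matrixP => a b; rewrite !mxE; ring.
- move=> L e.
  have z a b : (a <= k)%N -> (b <= d)%N ->
      (d - b)%:R * L 0 (inord (a + b)) + b%:R * L 1 (inord (a + b).-1) = 0.
    by move=> ak bd; rewrite -tauE // e mxE.
  (* Such an antidiagonal has two neighbouring entries, in the columns b = c - k (truncated) and b +
     1. Their difference gives l0 = l1, and the entry is then d l0. *)
  have mid c : (0 < c)%N -> (c < k + d)%N -> L 0 (inord c) = 0 /\ L 1 (inord c.-1) = 0.
    move=> c0 cD; set b := (c - k)%N.
    have bd : (b < d)%N by move: cD d_gt0; rewrite /b; clear; lia.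
    have bc : (b < c)%N by move: c0 k_gt0; rewrite /b; clear; lia.
    have := z (c - b)%N b; have := z (c - b.+1)%N b.+1.
    rewrite !subnK ?(ltnW bc) // => /(_ _ bd) z1 /(_ _ (ltnW bd)) z2.
    have bk1 : (c - b.+1 <= k)%N by rewrite /b; clear; lia.
    have bk2 : (c - b <= k)%N by rewrite /b; clear; lia.
    have {}z1 := z1 bk1; have {}z2 := z2 bk2.
    rewrite (natrB _ bd) in z1; rewrite (natrB _ (ltnW bd)) in z2.
    set l0 := L 0 _ in z1 z2 *; set l1 := L 1 _ in z1 z2 *.
    have e01 : l0 = l1.
      apply/eqP; rewrite -subr_eq0; apply/eqP.
      rewrite (_ : l0 - l1 = ((d%:R - b%:R) * l0 + b%:R * l1) - ((d%:R - b.+1%:R) * l0 +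
        b.+1%:R * l1)).
        by rewrite z1 z2 subrr.
      by rewrite -natr1; ring.
    have l00 : l0 = 0.
      apply: (mulfI dn0); rewrite mulr0 -z2 -e01; ring.
    by rewrite -e01 l00.
  (* The corner antidiagonals consist of the single entries d l0 and d l1. *)
  have e0 : L 0 (inord 0) = 0.
    by apply: (mulfI dn0); rewrite mulr0 -(z 0%N 0%N) // mul0r addr0 subn0.
  have e1 : L 1 (inord (k + d).-1) = 0.
    by apply: (mulfI dn0); rewrite mulr0 -(z k d) // subnn mul0r add0r.
  apply/matrixP => i c; rewrite mxE -(inord_val c).
  case: i => -[|[|//]] lt.
    rewrite (_ : Ordinal lt = 0); last exact: val_inj.
    have [->//|c0] := posnP c; have [|+ _] // := mid c c0.
    by move: (ltn_ord c) d_gt0; clear; lia.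
  rewrite (_ : Ordinal lt = 1); last exact: val_inj.
  have [lt'|ge'] := ltnP c.+1 (k + d).
    by have [_] := mid c.+1 (ltn0Sn _) lt'.
  rewrite (_ : nat_of_ord c = (k + d).-1) //.
  by move: (ltn_ord c) ge' d_gt0; clear; lia.
- move=> t; rewrite array_D2_eq0; split=> [H|[L ->] a b ak bd]; last first.
    rewrite !tauE; try by (move: ak bd; clear; lia).
    rewrite !addnS !addSn !natrB; try by (move: ak bd; clear; lia).
    by rewrite -!natr1; ring.
  pose g c b := t (inord (c - b)) (inord b).
  pose lo c := (c - k)%N.
  pose sl c := g c (lo c).+1 - g c (lo c).
  have aff c b : (c <= k + d)%N -> (lo c <= b)%N -> (b <= minn c d)%N ->
      g c b = g c (lo c) + (b%:R - (lo c)%:R) * sl c.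
    move=> cD lb bm; have := @affine_of_second_difference (g c) (lo c) (minn c d) _ (b - lo c)%N.
    rewrite subnKC // natrB // => -> // n ln nm.
    have := H (c - n.+2)%N n; rewrite /g.
    have e1 : ((c - n.+2).+1 = c - n.+1)%N by move: nm; clear; lia.
    have e2 : ((c - n.+1).+1 = c - n)%N by move: nm; clear; lia.
    by rewrite e1 e2; apply; move: ln nm cD; rewrite /lo; clear; lia.
  (* The values at b = 0 and b = d of the affine function on the antidiagonal, divided by d; in row
     1 the index l stands for c = l + 1. On a corner antidiagonal [sl] reads an entry lying
     elsewhere, but its factor is 0. *)
  exists (\matrix_(r, l) if r == 0 then (g l (lo l) - (lo l)%:R * sl l) / d%:R
     else (g l.+1 (lo l.+1) + (d%:R - (lo l.+1)%:R) * sl l.+1) / d%:R).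
  apply/matrixP => a b; rewrite !mxE /=.
  have ak := leq_ord a; have bd := leq_ord b.
  have -> : t a b = g (a + b)%N b by rewrite /g addnK !inord_val.
  rewrite aff; try by (move: ak bd; rewrite /lo; clear; lia).
  have [c0|c0] := posnP (a + b)%N.
    have b0 : nat_of_ord b = 0%N by move: c0; clear; lia.
    rewrite c0 b0 /lo sub0n inordK // subn0 !mul0r subrr !mul0r !addr0 subr0.
    by rewrite mulrC mulfVK.
  rewrite [nat_of_ord (inord (a + b).-1)]inordK ?prednK //; last first.
    by move: c0 ak bd d_gt0; clear; lia.
  have [cl|cl] := ltnP (a + b) (k + d).
    rewrite inordK; last by move: cl d_gt0; clear; lia.
    rewrite (natrB _ bd); move: (g _ _) (sl _) ((lo _)%:R : C) => x y l; by field.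
  have bD : nat_of_ord b = d by move: ak bd cl; clear; lia.
  by rewrite bD subnn mul0r add0r [RHS]mulrC mulfVK.
exists V => // L; rewrite HV.
(* The weights d - b and b in [tau] are the factors produced by differentiating X_0^(d-b) X_1^b; the
   derivative in X_1 also shifts the index by one. *)
have key j a : (a <= k)%N ->
    \sum_(b < d.+1) tau L (inord a) b * (F j)@_(mon2 d b) =
    \sum_r \sum_(b < d.-1.+1) L r (inord (a + b)) * (jacobian_form F r j)@_(mon2 d.-1 b).
  move=> ak; rewrite sum_ord2.
  have -> : \sum_(b < d.-1.+1) L 0 (inord (a + b)) * (jacobian_form F 0 j)@_(mon2 d.-1 b) =
      \sum_(b < d.+1) (d - b)%:R * L 0 (inord (a + b)) * (F j)@_(mon2 d b).
    rewrite [RHS]big_ord_recr /= subnn !mul0r addr0 prednK //; apply: eq_bigr => b _.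
    rewrite mxE mcoeff_mderiv.
    have -> : (mon2 d.-1 b + U_(0%R))%MM = mon2 d b.
      by rewrite mon2_addU0 ?prednK // -ltnS prednK.
    rewrite mon2_0 (_ : (d.-1 - b).+1 = (d - b)%N); last by move: (ltn_ord b) d_gt0; clear; lia.
    by rewrite -mulr_natl; ring.
  have -> : \sum_(b < d.-1.+1) L 1 (inord (a + b)) * (jacobian_form F 1 j)@_(mon2 d.-1 b) =
      \sum_(b < d.+1) b%:R * L 1 (inord (a + b).-1) * (F j)@_(mon2 d b).
    rewrite [RHS]big_ord_recl /= !mul0r add0r prednK //; apply: eq_bigr => b _.
    rewrite mxE mcoeff_mderiv /bump /= add1n.
    have -> : (mon2 d.-1 b + U_(1%R))%MM = mon2 d b.+1.
      by rewrite mon2_addU1 prednK.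
    by rewrite mon2_1 addnS /= -mulr_natl; ring.
  rewrite -big_split /=; apply: eq_bigr => b _.
  by rewrite mxE inordK // mulrDl.
by split=> H j a ak; [rewrite -key ?H | rewrite key ?H].
Qed.

End TangentArrays.

(** * The two dimension formulas *)

Theorem theorem1 (R : realType) (s d e : nat) (hs : (3 <= s)%N)
    (hd : (s < d)%N) (he : e.+1 = (d - s)%N)
    (T : {vspace dhomog 2 R[i] d}) (hT : \dim T = e.+1)
    (pi : 'Hom(dhomog 2 R[i] d, 'rV[R[i]]_s.+1))
    (hker : lker pi = T) (himg : limg pi = fullv)
    (hmor : forall p : 'rV[R[i]]_2, p != 0 -> veronese d p \notin T)
    (hbir : birational_onto_image (curve_forms pi))
    (hord : ordinary_singularities (curve_forms pi))
    (k : nat) (hk : (1 <= k)%N) :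
  h0_restricted_tangent (curve_forms pi) (- d%:Z - 2 - k%:Z)
    (\dim (lker (D (k + d)) :&: Sym_tens k T)) /\
  h0_normal (curve_forms pi) (- d%:Z - 2 - k%:Z)
    (\dim (lker (D2 (k + d)) :&: Sym_tens k T)).
Proof.
have d_gt0 : (0 < d)%N by exact: leq_ltn_trans hd.
have d1_gt0 : (0 < d.-1)%N by move: hs hd; clear; lia.
have hF := curve_forms_homog pi.
have F_base (p : 'rV[R[i]]_2) : p != 0 -> exists j, (curve_forms pi j).@[p 0] != 0.
  move=> p0; case: (boolP [exists j, (curve_forms pi j).@[p 0] != 0]) => [/existsP//|].
  rewrite negb_exists => /forallP H; case/negP: (hmor p p0).
  rewrite -hker memv_ker; apply/eqP/rowP => j; rewrite mxE -curve_formsE.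
  by have := H j; rewrite negbK => /eqP.
have rk := hord.1 _ (pt10_neq0 R[i]).
rewrite -hker; split.
  have [V <- HV] := tangent_array_dim k pi.
  apply: h0_restricted_tangent_transfer => //.
  apply: cech_h0 => // [r j|]; first by rewrite mxE.
  exact: form_row_inj.
have [V <- HV] := normal_array_dim pi hk d_gt0.
apply: h0_normal_transfer => //.
apply: cech_h0 => //; first exact: jacobian_form_homog.
exact: jacobian_form_inj.
Qed.
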